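(* Assume that the weak-coordinate sign is constant on each non-empty row: for every $j\in\{0,\ldots,m-1\}$ with $D_j\neq\varnothing$ there exists $\eta_j\in\{-1,1\}$ such that $\eta_{(i,j)}=\eta_j$ for all $i\in D_j$. Then the reflected carpet $K$ satisfies $$\dim_{\mathrm H} K=\frac{1}{\log m}\log\left(\sum_{j=0}^{m-1}t_j^{\beta}\right),$$ where $0^\beta=0$. In particular, if $\eta_d=1$ for all $d\in D$, then this formula holds for arbitrary choices of the horizontal signs $\sigma_d\in\{-1,1\}$, $d\in D$.
   Context: Let $2\le m<n$ be integers, let $D\subset\{0,\ldots,n-1\}\times\{0,\ldots,m-1\}$ be a non-empty digit set, and put $\beta=\log m/\log n$. For each digit $d=(i,j)\in D$ choose signs $\sigma_d,\eta_d\in\{-1,1\}$ and define $$S_d(x,y)=\left(\frac{\sigma_d x+a_d}{n},\frac{\eta_d y+b_d}{m}\right),$$ where $a_d=i$ if $\sigma_d=1$ and $a_d=i+1$ if $\sigma_d=-1$; and $b_d=j$ if $\eta_d=1$ and $b_d=j+1$ if $\eta_d=-1$. Thus $S_d([0,1]^2)=[i/n,(i+1)/n]\times[j/m,(j+1)/m]$. The reflected carpet $K$ is the attractor of $\{S_d:d\in D\}$, i.e. the unique non-empty compact set $K\subset\mathbb R^2$ with $K=\bigcup_{d\in D}S_d(K)$. The weak coordinate is the $y$-coordinate, and $\eta_d$ is the weak-coordinate sign of $d$. For $0\le j\le m-1$ write $D_j=\{i:(i,j)\in D\}$ (the $j$-th row) and $t_j=\#D_j$. $\dim_{\mathrm H}$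 denotes Hausdorff dimension. *)

(* Defs.v *)
From HB Require Import structures.
From mathcomp Require Import all_boot all_order all_algebra.
From mathcomp Require Import all_classical all_reals all_analysis.

Set Implicit Arguments.
Unset Strict Implicit.
Unset Printing Implicit Defensive.

Import Order.TTheory GRing.Theory Num.Theory.
Import numFieldNormedType.Exports.

Local Open Scope classical_set_scope.
Local Open Scope ring_scope.

(* The canonical norm on R * R is the sup norm, hence an explicit Euclidean
   distance.  The product topology used by [compact] below is the usual one. *)
Definition eucl_dist (R : realType) (p q : R * R) : R :=
  Num.sqrt ((p.1 - q.1) ^+ 2 + (p.2 - q.2) ^+ 2).

(* Only meaningful on non-empty sets: the value at [set0] is [-oo]. *)
Definition diam (R : realType) (A : set (R * R)) : \bar R :=
  ereal_sup [set (eucl_dist p q)%:E | p in A & q in A].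

(* |A|^s, with |set0|^s = 0 and |{p}|^0 = 1. *)
Definition diam_pow (R : realType) (s : R) (A : set (R * R)) : \bar R :=
  if `[< A = set0 >] then 0%E else (diam A `^ s)%E.

(* Finite covers are included, since members of a sequence may be empty. *)
Definition is_delta_cover (R : realType) (delta : R) (A : set (R * R))
    (U : nat -> set (R * R)) : Prop :=
  A `<=` \bigcup_k U k /\ forall k, (diam (U k) <= delta%:E)%E.

Definition hausdorff_content (R : realType) (s delta : R) (A : set (R * R)) :
    \bar R :=
  ereal_inf [set (\sum_(0 <= k <oo) diam_pow s (U k))%E |
             U in is_delta_cover delta A].

Definition hausdorff_measure (R : realType) (s : R) (A : set (R * R)) :
    \bar R :=
  ereal_sup [set hausdorff_content s delta A |
             delta in [set delta : R | 0 < delta]].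

Definition hausdorff_dim (R : realType) (A : set (R * R)) : \bar R :=
  ereal_inf [set s%:E | s in [set s : R | 0 <= s /\
                                          hausdorff_measure s A = 0%E]].

Definition is_sign (s : int) : Prop := s = 1 \/ s = -1.

Definition sign_shift (s : int) (k : nat) : nat := if s == 1 then k else k.+1.

Definition carpet_map (R : realType) (n m : nat)
    (sigma eta : 'I_n * 'I_m -> int) (d : 'I_n * 'I_m) (p : R * R) : R * R :=
  (((sigma d)%:~R * p.1 + (sign_shift (sigma d) d.1)%:R) / n%:R,
   ((eta d)%:~R * p.2 + (sign_shift (eta d) d.2)%:R) / m%:R).

Definition is_carpet (R : realType) (n m : nat) (D : {set 'I_n * 'I_m})
    (sigma eta : 'I_n * 'I_m -> int) (K : set (R * R)) : Prop :=
  [/\ K !=set0, compact K &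
      K = \bigcup_(d in [set` D]) (carpet_map sigma eta d @` K)].

Definition digit_row (n m : nat) (D : {set 'I_n * 'I_m}) (j : 'I_m) :
    {set 'I_n} := [set i | (i, j) \in D]%SET.

Definition row_constant (n m : nat) (D : {set 'I_n * 'I_m})
    (eta : 'I_n * 'I_m -> int) : Prop :=
  forall j : 'I_m, digit_row D j <> finset.set0 ->
    exists e : int, is_sign e /\
      forall i : 'I_n, i \in digit_row D j -> eta (i, j) = e.

Definition beta (R : realType) (n m : nat) : R := ln m%:R / ln n%:R.

(* [powR 0 b = 0] for [b != 0], and [beta] is positive when [1 < m < n]. *)
Definition carpet_dim (R : realType) (n m : nat) (D : {set 'I_n * 'I_m}) : R :=
  (ln m%:R)^-1 *
  ln (\sum_(j < m) (#|digit_row D j|%:R `^ beta R n m)).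

(* Main.v *)
Require Import Defs.
From HB Require Import structures.
From mathcomp Require Import all_boot all_order all_algebra.
From mathcomp Require Import all_classical all_reals all_analysis.
From mathcomp Require Import zify ring lra.

Set Implicit Arguments.
Unset Strict Implicit.
Unset Printing Implicit Defensive.

Import Order.TTheory GRing.Theory Num.Theory.
Import numFieldNormedType.Exports.

Local Open Scope classical_set_scope.
Local Open Scope ring_scope.

(** Both bounds are finite combinatorics on words over the digit set.  Put
    [t d] for the size of the row of [d] and [M = \sum_d t d ^ (beta - 1)], so that
    [M = \sum_j t_j ^ beta].  An approximate square prescribes the first [L]
    digits and the rows of the first [k] digits of a point, where
    [n ^ L <= m ^ k]; since weak signs depend on the row only, its image in [K]
    has diameter [O(m ^ -k)].

    Upper bound: give each approximate square the weight
    [\prod_(i <= L) t_i ^ (beta - 1) * \prod_(L < i <= k) t_i ^ beta].  The weights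
    at one scale sum to [M ^ k].  Along consecutive scales [L < k] the mean of
    [ln t] cannot keep dropping by a fixed amount, hence every point of [K]
    lies, at one of boundedly many scales, in a square of weight at least
    [expR (- e k)], and there are at most [expR (e k) M ^ k] such squares.

    Lower bound: if all rows have the same size, counting the words whose image
    of a fixed point lies in a given ball bounds every finite cover by balls
    from below.  The general case reduces to this one: grouping words of length
    [N] by the product of their row sizes gives polynomially many classes, and
    each class is a carpet for [(n ^ N, m ^ N)] with rows of equal size. *)

(** * Words and their affine maps *)

(** The increasing ([f = false]) or decreasing ([f = true]) affine bijection of the unit interval
    onto the interval [[i/b, (i+1)/b]]. *)
Definition flip_map (R : realType) (b : nat) (f : bool) (i : nat) (x : R) : R :=
  (if f then i.+1%:R - x else i%:R + x) / b%:R.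

Section Word.
Variables (T : Type) (b : nat) (i : T -> nat) (f : T -> bool).

(** Index [p] for which the word maps the unit interval onto [[p/b^k, (p+1)/b^k]], [k] being the
    length of the word. A flipping first letter mirrors the index of the tail; for digits below [b]
    the truncated subtraction is exact. *)
Fixpoint word_pos (w : seq T) : nat :=
  if w is a :: w' then
    (i a * b ^ size w' +
     (if f a then b ^ size w' - (word_pos w').+1 else word_pos w'))%N
  else 0%N.

Definition word_flip (w : seq T) : bool := foldr (fun a c => f a (+) c) false w.

Definition word_map (R : realType) (w : seq T) (x : R) : R :=
  foldr (fun a => flip_map b (f a) (i a)) x w.

Lemma word_map_cat (R : realType) (u v : seq T) (x : R) :
  word_map (u ++ v) x = word_map u (word_map v x).
Proof. by rewrite /word_map foldr_cat. Qed.

Lemma word_pos_lt (w : seq T) :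
  all (fun a => i a < b)%N w -> (word_pos w < b ^ size w)%N.
Proof.
elim: w => [|a w IH] //= /andP[ia /IH lt_w].
rewrite expnS; have := leq_mul ia (leqnn (b ^ size w)).
by rewrite mulSn; case: ifP => _; lia.
Qed.

(** Flip maps are closed under composition, the bases being multiplied. This is what lets a block of
    letters act as a single digit in base [b ^ N]. *)
Lemma word_mapE (R : realType) (w : seq T) (x : R) :
  (0 < b)%N -> all (fun a => i a < b)%N w ->
  word_map w x = flip_map (b ^ size w) (word_flip w) (word_pos w) x.
Proof.
move=> b0; elim: w => [|a w IH] //=.
  by rewrite /flip_map expn0 add0r divr1.
move=> /andP[ia aw]; rewrite (IH aw) /flip_map.
have lt_w := word_pos_lt aw.
have b_neq0 : b%:R != 0 :> R by rewrite pnatr_eq0 -lt0n.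
have bw_neq0 : (b ^ size w)%:R != 0 :> R.
  by rewrite pnatr_eq0 -lt0n expn_gt0 b0.
rewrite expnS natrM.
case: (f a) => /=; case: (word_flip w) => /=;
  rewrite -?natr1 !natrD !natrM ?natrB // -?natr1; by field; apply/andP.
Qed.

End Word.

(** Digits are read off from the leading one. A mirrored tail can be undone only if both words flip
    alike there; the labels [e] supply whatever information, beyond the digit, determines the
    flip. *)
Lemma word_pos_inj (T E : eqType) (b : nat) (i : T -> nat) (f : T -> bool)
    (e : T -> E) (D : seq T) :
  {in D, forall a, i a < b}%N ->
  {in D &, forall a c, e a = e c -> i a = i c -> f a = f c} ->
  forall w z : seq T, {subset w <= D} -> {subset z <= D} ->
  map e w = map e z -> word_pos b i f w = word_pos b i f z ->
  map i w = map i z.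
Proof.
move=> ib ef; elim=> [|a w IH] [|c z] //= wD zD [eac ewz].
have szE : size w = size z by rewrite -(size_map e w) ewz size_map.
have aD : a \in D by apply: wD; rewrite mem_head.
have cD : c \in D by apply: zD; rewrite mem_head.
have wD' : {subset w <= D} by move=> x xw; apply: wD; rewrite inE xw orbT.
have zD' : {subset z <= D} by move=> x xz; apply: zD; rewrite inE xz orbT.
have ltw : (word_pos b i f w < b ^ size w)%N.
  by apply/word_pos_lt/allP => x /wD' /ib.
have ltz : (word_pos b i f z < b ^ size w)%N.
  by rewrite szE; apply/word_pos_lt/allP => x /zD' /ib.
rewrite -szE => posE.
have iac : i a = i c.
  (* Division by [b ^ size w] isolates the leading digit: the tail index, mirrored or not, stays
     below the divisor. *)
  have : ((i a * b ^ size w + (if f a then b ^ size w - (word_pos b i f w).+1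
           else word_pos b i f w)) %/ b ^ size w =
          (i c * b ^ size w + (if f c then b ^ size w - (word_pos b i f z).+1
           else word_pos b i f z)) %/ b ^ size w)%N by rewrite posE.
  rewrite !divnMDl; [|by lia..].
  by rewrite !divn_small ?addn0 //; case: ifP => _; lia.
rewrite iac; congr cons; apply: IH => //.
move: posE; rewrite iac (ef _ _ aD cD eac iac).
by case: ifP => _; lia.
Qed.

(** * Enumerating and counting words *)

Fixpoint words (T : Type) (D : seq T) (k : nat) : seq (seq T) :=
  if k is k'.+1 then [seq a :: w | a <- D, w <- words D k'] else [:: [::]].

Lemma mem_words (T : eqType) (D : seq T) (k : nat) (w : seq T) :
  (w \in words D k) = (size w == k) && all (mem D) w.
Proof.
elim: k w => [|k IH] [|a w] //=.
  by apply/negbTE/allpairsP => -[[? ?] []].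
apply/allpairsP/idP => [[[c z] [/= cD zw [-> ->]]]|].
  by move: zw; rewrite IH eqSS cD.
move=> /andP[sw /andP[aD aw]]; exists (a, w); split=> //.
by rewrite IH -eqSS sw.
Qed.

Lemma words_uniq (T : eqType) (D : seq T) (k : nat) :
  uniq D -> uniq (words D k).
Proof.
move=> uD; elim: k => //= k IH; apply: allpairs_uniq => //.
by move=> [a w] [c z] _ _ [/= -> ->].
Qed.

Lemma size_words (T : Type) (D : seq T) (k : nat) :
  size (words D k) = (size D ^ k)%N.
Proof. by elim: k => //= k IH; rewrite size_allpairs IH expnS. Qed.

Lemma sum_words_prod (S : comPzSemiRingType) (T : Type) (D : seq T) (k : nat)
    (F : T -> S) :
  \sum_(w <- words D k) \prod_(a <- w) F a = (\sum_(a <- D) F a) ^+ k.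
Proof.
elim: k => [|k IH] /=; first by rewrite big_seq1 big_nil.
rewrite big_allpairs_dep exprS mulr_suml; apply: eq_bigr => a _.
by rewrite -IH mulr_sumr; apply: eq_bigr => w _; rewrite big_cons.
Qed.

Definition fibre (T : Type) (D : seq T) (row : T -> nat) (j : nat) : nat :=
  count (fun c => row c == j) D.

(** Cardinality of an approximate square: the first [L] letters are forced, each of the next [k - L]
    ranges over its row, and the remaining ones are free. *)
Lemma count_words (T : eqType) (D : seq T) (row : T -> nat) (L k : nat)
    (w0 : seq T) :
  uniq D -> {subset w0 <= D} -> (L <= k <= size w0)%N ->
  count (fun w => (take L w == take L w0) &&
                  (map row (take k w) == map row (take k w0)))
        (words D (size w0)) =
  (\prod_(a <- drop L (take k w0)) fibre D row (row a) *
   size D ^ (size w0 - k))%N.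
Proof.
move=> uD; elim: w0 L k => [|a w0 IH] L k w0D /=.
  by rewrite leqn0 => /andP[_ /eqP ->]; rewrite big_nil.
have aD : a \in D by apply: w0D; rewrite mem_head.
have w0D' : {subset w0 <= D} by move=> x xw; apply: w0D; rewrite inE xw orbT.
have cnt (F : pred (seq T)) : count F [seq c :: w | c <- D, w <- words D (size w0)]
    = (\sum_(c <- D) count (fun w => F (c :: w)) (words D (size w0)))%N.
  rewrite -sum1_count big_mkcond big_allpairs_dep; apply: eq_bigr => c _.
  by rewrite -big_mkcond sum1_count.
rewrite {}cnt; case: k => [|k].
  rewrite leqn0 => /andP[/eqP -> _] /=; rewrite big_nil mul1n subn0.
  under eq_bigr => c _ do rewrite count_predT size_words.
  by rewrite big_const_seq count_predT iter_addn_0 expnS mulnC.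
rewrite ltnS subSS; case: L => [|L] /=.
  move=> kw; rewrite big_cons -mulnA.
  have := IH 0%N k w0D' kw; rewrite take0 drop0 => <-.
  rewrite /fibre -sum1_count big_distrl /= [RHS]big_mkcond.
  apply: eq_bigr => c _; case: eqP => [rc|rc].
    rewrite mul1n; apply: eq_count => w /=.
    by rewrite rc eqseq_cons eqxx take0.
  apply/eqP; rewrite -leqn0 leqNgt -has_count; apply/hasPn => w _.
  by apply/negP => /eqP[] /rc.
rewrite ltnS => Lkw; rewrite -IH //.
rewrite (bigD1_seq a) //= [X in (_ + X)%N]big1 ?addn0.
  by apply: eq_count => w; rewrite !eqseq_cons !eqxx.
move=> c /negbTE ca; apply/eqP; rewrite -leqn0 leqNgt -has_count.
by apply/hasPn => w _; rewrite eqseq_cons ca.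
Qed.

Lemma sum_undup_map (S : pzSemiRingType) (T J : eqType) (D : seq T)
    (h : T -> J) (F : J -> S) :
  \sum_(a <- D) F (h a) =
  \sum_(j <- undup (map h D)) (count (fun a => h a == j) D)%:R * F j.
Proof.
under [RHS]eq_bigr => j _ do rewrite -sum1_count natr_sum mulr_suml.
rewrite (exchange_big_dep xpredT) //= big_seq [RHS]big_seq.
apply: eq_bigr => a aD.
rewrite [RHS]big_mkcond [RHS](bigD1_seq (h a)) ?undup_uniq //=.
  rewrite eqxx mul1r [X in _ = _ + X]big1 ?addr0 // => j; rewrite eq_sym.
  by move=> /negbTE ->.
by rewrite mem_undup map_f.
Qed.

(** * Systems of digits *)

Lemma flip_map_dist (R : realType) (b : nat) (f : bool) (i : nat) (x y : R) :
  `|flip_map b f i x - flip_map b f i y| = `|x - y| / b%:R.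
Proof.
have -> : flip_map b f i x - flip_map b f i y = (-1) ^+ f * (x - y) / b%:R.
  by rewrite /flip_map; case: f; rewrite ?expr1 ?expr0; ring.
by rewrite normrM normrM normrX normrN1 expr1n mul1r normfV normr_nat.
Qed.

Lemma flip_map_pos (R : realType) (b : nat) (f : bool) (i : nat) (x : R) :
  (0 < b)%N -> `|i%:R - b%:R * flip_map b f i x| <= `|x| + 1.
Proof.
move=> b0; have b_neq0 : b%:R != 0 :> R by rewrite pnatr_eq0 -lt0n.
rewrite /flip_map mulrCA divff // mulr1.
case: f; rewrite -?natr1.
  have -> : i%:R - (i%:R + 1 - x) = x - 1 :> R by ring.
  by rewrite (le_trans (ler_normB _ _)) // normr1.
have -> : i%:R - (i%:R + x) = - x :> R by ring.
by rewrite normrN lerDl.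
Qed.

(** Take [lo] to be the least natural number within [B] of [z], if there is one; any other lies at
    most [2 B] above it. *)
Lemma nat_window (R : realType) (z : R) (B : nat) :
  exists lo : nat, forall p : nat, `|p%:R - z| <= B%:R ->
    p \in iota lo (B.*2).+1.
Proof.
have [[p0 p0z]|none] := pselect (exists p : nat, `|p%:R - z| <= B%:R); last first.
  by exists 0%N => p pz; case: none; exists p.
have [lo loz lo_min] :=
  ex_minnP (ex_intro (fun p : nat => `|p%:R - z| <= B%:R) _ p0z).
exists lo => p pz; rewrite mem_iota (lo_min _ pz) /= addnS ltnS -(ler_nat R).
rewrite natrD -addnn natrD.
move: loz pz; rewrite !ler_norml => /andP[? ?] /andP[? ?].
lra.
Qed.

Lemma count_cover (T I : eqType) (s : seq T) (J : seq I) (Q : pred T)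
    (F : I -> pred T) :
  {in s, forall w, Q w -> has (fun i => F i w) J} ->
  (count Q s <= \sum_(i <- J) count (F i) s)%N.
Proof.
elim: s => [|w s IH] QF /=; first by [].
rewrite big_split /= leq_add ?IH //; last first.
  by move=> z zs; apply: QF; rewrite inE zs orbT.
have := QF w (mem_head _ _); case: (Q w) => // /(_ isT).
by rewrite has_count -sum1_count big_mkcond; case: (X in (0 < X)%N).
Qed.

(** Letters have an arbitrary type so that blocks of words form such a system again, for powers of
    [n] and [m]. The last clause is the constancy of the weak sign on rows. *)
Definition row_system (T : eqType) (n m : nat) (D : seq T) (col row : T -> nat)
    (fy : T -> bool) : Prop :=
  [/\ uniq D, {in D, forall a, (col a < n)%N /\ (row a < m)%N},
      {in D &, forall a c, col a = col c -> row a = row c -> a = c} &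
      {in D &, forall a c, row a = row c -> fy a = fy c}].

Section System.
Variables (R : realType) (T : eqType) (n m : nat) (D : seq T).
Variables (col row : T -> nat) (fx fy : T -> bool).
Hypothesis sysD : row_system n m D col row fy.

(** The weak flip is a function of the row, so positions can be decoded with a trivial label. *)
Lemma row_word_inj (w z : seq T) : {subset w <= D} -> {subset z <= D} ->
  size w = size z ->
  word_pos m row fy w = word_pos m row fy z -> map row w = map row z.
Proof.
case: sysD => _ lt _ fyr wD zD szE; apply: (word_pos_inj (e := fun=> tt)) wD zD _.
- by move=> a /lt[].
- by move=> a c aD cD _; apply: fyr.
- apply: (@eq_from_nth _ tt); rewrite ?size_map // => i _.
  by case: (nth _ _ _); case: (nth _ _ _).
Qed.

(** The horizontal flip depends on the whole letter. Once the rows are known, row and column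
    together determine the letter, so the rows serve as labels for decoding. *)
Lemma word_inj (w z : seq T) : {subset w <= D} -> {subset z <= D} ->
  map row w = map row z ->
  word_pos n col fx w = word_pos n col fx z -> w = z.
Proof.
case: sysD => _ lt inj fyr wD zD rowE posE.
have : map col w = map col z.
  apply: (word_pos_inj (e := row)) wD zD rowE posE.
    by move=> a /lt[].
  by move=> a c aD cD r_ c_; rewrite (inj a c).
elim: w z wD zD rowE {posE} => [|a w IH] [|c z] //= wD zD [rac rwz] [cac cwz].
congr cons; first by apply: inj => //; [apply: wD|apply: zD]; rewrite mem_head.
apply: IH => // x xs; first by apply: wD; rewrite inE xs orbT.
by apply: zD; rewrite inE xs orbT.
Qed.

Definition stable (K : set (R * R)) : Prop :=
  {in D, forall a p, K p ->
     K (flip_map n (fx a) (col a) p.1, flip_map m (fy a) (row a) p.2)}.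

Lemma word_stable (K : set (R * R)) (w : seq T) (p : R * R) :
  stable K -> {subset w <= D} -> K p ->
  K (word_map n col fx w p.1, word_map m row fy w p.2).
Proof.
move=> stK; elim: w => [|a w IH] wD Kp /=; first by case: p Kp.
have aD : a \in D by apply: wD; rewrite mem_head.
apply: (stK _ aD (_, _)); apply: IH => // x xw.
by apply: wD; rewrite inE xw orbT.
Qed.

(** The ball confines the column position at depth [L] and the row position at depth [k] to
    boundedly many values. Each pair of positions determines one approximate square, whose words are
    counted exactly. *)
Lemma count_near (B t L k P : nat) (p0 q : R * R) (r : R) :
  (0 < m)%N -> (0 < n)%N ->
  (forall w, {subset w <= D} ->
     `|word_map n col fx w p0.1| <= B%:R /\
     `|word_map m row fy w p0.2| <= B%:R) ->
  {in D, forall a, fibre D row (row a) = t} ->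
  (L <= k <= P)%N ->
  (n ^ L)%:R * r <= 1 -> (m ^ k)%:R * r <= 1 ->
  (count (fun w => (`|word_map n col fx w p0.1 - q.1| < r)%R &&
                   (`|word_map m row fy w p0.2 - q.2| < r)%R) (words D P) <=
   (B.+2.*2).+1 ^ 2 * (t ^ (k - L) * size D ^ (P - k)))%N.
Proof.
move=> m0 n0 bnd fibD /andP[Lk kP] nr mr.
case: (sysD) => uD ltD injD fyrD.
have [lox lox_in] := nat_window ((n ^ L)%:R * q.1) B.+2.
have [loy loy_in] := nat_window ((m ^ k)%:R * q.2) B.+2.
set C := (B.+2.*2).+1 in lox_in loy_in *.
pose J := [seq (u, v) | u <- iota lox C, v <- iota loy C].
pose F (i : nat * nat) (w : seq T) :=
  (word_pos n col fx (take L w) == i.1) && (word_pos m row fy (take k w) == i.2).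
have sub_take l w : {subset w <= D} -> {subset take l w <= D}.
  by move=> wD x /mem_take /wD.
have sub_drop l w : {subset w <= D} -> {subset drop l w <= D}.
  by move=> wD x /mem_drop /wD.
(* After scaling by [b ^ l], the distance from the index to the image point is at most [B + 1] and
   the radius adds at most 1; hence the bound [B + 2]. *)
have near (b : nat) (i : T -> nat) (f : T -> bool) (x0 x : R) (l : nat) (w : seq T) :
    (0 < b)%N -> all (fun a => i a < b)%N w -> (l <= size w)%N ->
    `|word_map b i f (drop l w) x0| <= B%:R -> (b ^ l)%:R * r <= 1 ->
    `|word_map b i f w x0 - x| < r ->
    `|(word_pos b i f (take l w))%:R - (b ^ l)%:R * x| <= B.+2%:R.
  move=> b0 iw lw bw bl wx.
  have tw : all (fun a => i a < b)%N (take l w).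
    by apply/allP => a /mem_take aw; exact: (allP iw).
  move: wx; rewrite -[in word_map _ _ _ _ _](cat_take_drop l w) word_map_cat.
  rewrite word_mapE // size_takel //.
  set y := word_map _ _ _ (drop l w) x0 in bw *; set i' := word_pos _ _ _ _.
  have := flip_map_pos (word_flip f (take l w)) i' y (_ : 0 < b ^ l)%N.
  rewrite expn_gt0 b0 => /(_ isT); set g := flip_map _ _ _ _ => gy gx.
  have -> : i'%:R - (b ^ l)%:R * x =
    (i'%:R - (b ^ l)%:R * g) + (b ^ l)%:R * (g - x) by ring.
  apply: le_trans (ler_normD _ _) _.
  have : `|(b ^ l)%:R * (g - x)| <= 1.
    rewrite normrM normr_nat (le_trans _ bl) //.
    by rewrite ler_wpM2l // ltW.
  by rewrite -!natr1; move: gy bw; lra.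
apply: (@leq_trans (\sum_(i <- J) count (F i) (words D P))%N).
  apply: count_cover => w; rewrite mem_words => /andP[/eqP sw /allP wD].
  move=> /andP[wx wy]; apply/hasP.
  exists (word_pos n col fx (take L w), word_pos m row fy (take k w)); last first.
    by rewrite /F !eqxx.
  apply/allpairsP.
  exists (word_pos n col fx (take L w), word_pos m row fy (take k w)).
  split=> //=.
    apply: lox_in; apply: near wx => //.
    - by apply/allP => a /wD /ltD[].
    - by rewrite sw (leq_trans Lk).
    - by case: (bnd (drop L w)) => //; apply: sub_drop.
  apply: loy_in; apply: near wy => //.
  - by apply/allP => a /wD /ltD[].
  - by rewrite sw.
  - by case: (bnd (drop k w)) => //; apply: sub_drop.
have -> : (C ^ 2)%N = size J by rewrite size_allpairs !size_iota.
rewrite -sum1_size big_distrl /=; apply: leq_sum => i _; rewrite mul1n.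
(* A non-empty class has a representative [w0], and all its words lie in the approximate square of
   [w0]. *)
have [|/hasPn none] := boolP (has (F i) (words D P)); last first.
  by rewrite (eq_in_count (a2 := pred0)) ?count_pred0 // => w /none /negbTE.
move=> /hasP[w0]; rewrite mem_words => /andP[/eqP sw0 /allP w0D].
move=> /andP[/eqP w0x /eqP w0y].
have Lk0 : (L <= k <= size w0)%N by rewrite Lk sw0.
have := count_words row uD w0D Lk0; rewrite sw0.
rewrite [X in (X * _)%N](_ : _ = t ^ (k - L))%N; last first.
  rewrite big_seq (eq_bigr (fun=> t)); last first.
    by move=> a /sub_drop aD; apply: fibD; apply: aD; apply: sub_take.
  rewrite -big_seq big_const_seq count_predT size_drop size_takel ?sw0 //.
  by elim: (k - L)%N => //= j ->; rewrite expnS.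
move=> <-; rewrite -[X in (X <= _)%N]size_filter -[X in (_ <= X)%N]size_filter.
apply: uniq_leq_size; first by rewrite filter_uniq // words_uniq.
move=> w; rewrite !mem_filter mem_words => /andP[/andP[/eqP wx /eqP wy]].
move=> /[dup] wP /andP[/eqP sw /allP wD]; rewrite wP andbT.
have rowE : map row (take k w) = map row (take k w0).
  apply: row_word_inj; [exact: sub_take|exact: sub_take| |by rewrite wy w0y].
  by rewrite !size_take sw sw0.
rewrite rowE eqxx andbT; apply/eqP/word_inj; [exact: sub_take|exact: sub_take| |].
  have := congr1 (take L) rowE.
  by rewrite -!map_take !take_takel.
by rewrite wx w0x.
Qed.

End System.

(** * Lower bound for rows of equal size *)

Lemma ln_nat_gt0 (R : realType) (m : nat) : (1 < m)%N -> 0 < ln (m%:R : R).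
Proof. by move=> m1; rewrite ln_gt0 // ltr1n. Qed.

Lemma beta_gt0 (R : realType) (n m : nat) : (1 < m < n)%N -> 0 < beta R n m.
Proof.
by move=> /andP[m1 mn]; rewrite divr_gt0 // ln_nat_gt0 // (ltn_trans m1).
Qed.

Lemma beta_lt1 (R : realType) (n m : nat) : (1 < m < n)%N -> beta R n m < 1.
Proof.
move=> /andP[m1 mn]; have n1 := ltn_trans m1 mn.
by rewrite ltr_pdivrMr ?ln_nat_gt0 // mul1r ltr_ln ?ltr_nat // posrE ltr0n ltnW.
Qed.

Lemma ler_ln_nat_exp (R : realType) (m n k l : nat) : (0 < m)%N -> (0 < n)%N ->
  (ln (m%:R : R) * k%:R <= ln n%:R * l%:R) = (m ^ k <= n ^ l)%N.
Proof.
move=> m0 n0; rewrite !mulr_natr -!lnXn ?ltr0n // -!natrX ler_ln ?ler_nat //;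
  by rewrite posrE ltr0n expn_gt0 ?m0 ?n0.
Qed.

Lemma ler_betaM (R : realType) (n m k l : nat) : (1 < m < n)%N ->
  (beta R n m * k%:R <= l%:R) = (m ^ k <= n ^ l)%N.
Proof.
move=> /andP[m1 mn]; have n1 := ltn_trans m1 mn.
rewrite mulrAC ler_pdivrMr ?ln_nat_gt0 // [l%:R * _]mulrC.
by rewrite ler_ln_nat_exp // ltnW.
Qed.

Lemma ler_Mbeta (R : realType) (n m k l : nat) : (1 < m < n)%N ->
  (l%:R <= beta R n m * k%:R) = (n ^ l <= m ^ k)%N.
Proof.
move=> /andP[m1 mn]; have n1 := ltn_trans m1 mn.
rewrite mulrAC ler_pdivlMr ?ln_nat_gt0 // [l%:R * _]mulrC.
by rewrite ler_ln_nat_exp // ltnW.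
Qed.

Lemma powR_ge1 (R : realType) (a s : R) : 1 <= a -> 0 <= s -> 1 <= a `^ s.
Proof. by move=> a1 s0; rewrite -(powRr0 a) ler_powR. Qed.

(** The level is the integer part of the base-[m] logarithm of [1/r]. *)
Lemma level_exists (R : realType) (m : nat) (r : R) : (1 < m)%N -> 0 < r < 1 ->
  exists k : nat, (m ^ k)%:R * r <= 1 /\ 1 <= (m ^ k.+1)%:R * r.
Proof.
move=> m1 /andP[r0 r1]; have /truncn_itv/andP[lo hi] : 0 <= r^-1.
  by rewrite invr_ge0 ltW.
set N := Num.trunc _ in lo hi; have N0 : (0 < N)%N.
  by rewrite lt0n; apply: contraL hi => /eqP ->; rewrite -leNgt invf_ge1 // ltW.
exists (trunc_log m N); split.
  rewrite -ler_pdivlMr // div1r; apply: le_trans lo.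
  by rewrite ler_nat trunc_logP.
rewrite -ler_pdivrMr // div1r.
by apply: le_trans (ltW hi) _; rewrite ler_nat trunc_log_ltn.
Qed.

Section Uniform.
Variables (R : realType) (T : eqType) (n m : nat) (D : seq T).
Variables (col row : T -> nat) (fx fy : T -> bool).
Hypothesis sysD : row_system n m D col row fy.
Hypothesis mn : (1 < m < n)%N.

(** From [m ^ k < n ^ L.+1] one gets [k - L <= (1 - beta) k + 1], so the [k]-th power of [tD]
    dominates the count up to a factor [t]. The factor [m ^ s] pays for rounding [r] to a power of
    [m]. *)
Lemma uniform_level_bound (t k L : nat) (s r : R) :
  (0 < t)%N -> 0 <= s -> 0 < r ->
  m%:R `^ s * t%:R `^ (1 - beta R n m) <= (size D)%:R ->
  (m ^ k < n ^ L.+1)%N -> (L <= k)%N -> 1 <= (m ^ k.+1)%:R * r ->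
  (t ^ (k - L))%:R <= (size D)%:R ^+ k * (t%:R * m%:R `^ s) * r `^ s.
Proof.
move=> t0 s0 r0 tD mk Lk mr; case/andP: (mn) => m1 ltmn.
set b := beta R n m in tD *.
have m0 : 0 <= m%:R :> R by [].
have t1 : 1 <= t%:R :> R by rewrite ler1n.
apply: (@le_trans _ _ ((m%:R `^ s * t%:R `^ (1 - b)) ^+ k *
                      (t%:R * m%:R `^ s) * r `^ s)); last first.
  rewrite -!mulrA ler_wpM2r ?mulr_ge0 ?powR_ge0 //.
  by rewrite lerXn2r // nnegrE ?mulr_ge0 ?powR_ge0.
have -> : (m%:R `^ s * t%:R `^ (1 - b)) ^+ k * (t%:R * m%:R `^ s) * r `^ s =
    ((m ^ k.+1)%:R * r) `^ s * t%:R `^ ((1 - b) * k%:R + 1).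
  rewrite [X in _ = _ * X]powRD; last by rewrite pnatr_eq0 -lt0n t0 implybT.
  rewrite powRr1 ?ler0n // natrX powRM ?exprn_ge0 ?(ltW r0) //.
  rewrite [t%:R `^ (_ * _)]powRrM powR_mulrn ?powR_ge0 //.
  rewrite -(powR_mulrn k.+1) // -powRrM [k.+1%:R * _]mulrC powRrM.
  rewrite powR_mulrn ?powR_ge0 // exprMn exprS; ring.
apply: (@le_trans _ _ (t%:R `^ ((1 - b) * k%:R + 1))); last first.
  by rewrite ler_peMl ?powR_ge0 // powR_ge1.
rewrite natrX -powR_mulrn // ler_powR // natrB //.
have := ltnW mk; rewrite -(ler_betaM R _ _ mn) -/b -natr1; lra.
Qed.

(** A mass distribution argument with counting measure on words of one length [P]: every word sends
    [p0] into some ball, while a ball of radius [r] receives at most a multiple of [r ^ s] of all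
    words. *)
Lemma uniform_cover_lower (K : set (R * R)) (p0 : R * R) (B t : nat) (s : R) :
  stable n m D col row fx fy K -> K p0 ->
  (forall p, K p -> `|p.1| <= B%:R /\ `|p.2| <= B%:R) ->
  (0 < size D)%N -> {in D, forall a, fibre D row (row a) = t} ->
  0 <= s -> m%:R `^ s * t%:R `^ (1 - beta R n m) <= (size D)%:R ->
  exists2 c : R, 0 < c & forall (F : seq nat) (x : nat -> R * R) (r : nat -> R),
    {in F, forall k, 0 < r k} ->
    (forall p, K p -> exists2 k, k \in F &
       `|p.1 - (x k).1| < r k /\ `|p.2 - (x k).2| < r k) ->
    c <= \sum_(k <- F) r k `^ s.
Proof.
move=> stK Kp0 bndK D0 fibD s0 tD; case/andP: (mn) => m1 ltmn.
have n1 := ltn_trans m1 ltmn; have m0 := ltnW m1; have n0 := ltnW n1.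
have t0 : (0 < t)%N.
  case: D D0 fibD => // a D' _ /(_ a (mem_head _ _)) <-.
  by rewrite /fibre -has_count /= eqxx.
set C := ((B.+2.*2).+1 ^ 2)%N.
have C0 : (0 < C)%N by rewrite expn_gt0.
pose A : R := C%:R * (t%:R * m%:R `^ s).
have A1 : 1 <= A.
  rewrite mulr_ege1 ?ler1n // mulr_ege1 ?ler1n // powR_ge1 // ler1n.
  exact: ltnW.
have A0 : 0 < A by apply: lt_le_trans A1.
exists A^-1; first by rewrite invr_gt0.
move=> F x r rF cov.
(* A ball of radius at least 1 already contributes 1, which exceeds [A^-1]. *)
have [/hasP[k kF rk]|/hasPn r1] := boolP (has (fun k => 1 <= r k) F).
  rewrite (big_rem k) //= ler_wpDr ?sumr_ge0 //.
    by move=> i _; exact: powR_ge0.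
  by apply: (@le_trans _ _ 1); [rewrite invf_le1|exact: powR_ge1].
have lev k : exists kk, k \in F ->
    (m ^ kk)%:R * r k <= 1 /\ 1 <= (m ^ kk.+1)%:R * r k.
  have [kF|] := boolP (k \in F); last by exists 0%N.
  have r01 : 0 < r k < 1 by rewrite rF // ltNge r1.
  by have [kk kkP] := level_exists m1 r01; exists kk.
have [lv lvP] := choice lev.
(* [L k] is the integer part of [beta * lv k]; [P] is the deepest row level in the cover, so one
   word length serves all balls. *)
pose L k := trunc_log n (m ^ lv k).
pose P := (\max_(k <- F) lv k)%N.
have Llv k : (L k <= lv k)%N.
  rewrite -(@leq_exp2l n) // (leq_trans (trunc_logP _ _)) ?expn_gt0 ?m0 //.
  by case: (lv k) => // j; rewrite leq_exp2r // ltnW.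
have step : (size D ^ P <= \sum_(k <- F)
    C * (t ^ (lv k - L k) * size D ^ (P - lv k)))%N.
  rewrite -size_words -count_predT.
  apply: (@leq_trans (\sum_(k <- F) count (fun w =>
       (`|word_map n col fx w p0.1 - (x k).1| < r k)%R &&
       (`|word_map m row fy w p0.2 - (x k).2| < r k)%R) (words D P))).
    apply: count_cover => w; rewrite mem_words => /andP[_ /allP wD] _.
    have [k kF [kx ky]] := cov _ (word_stable stK wD Kp0).
    by apply/hasP; exists k; rewrite //= kx ky.
  rewrite big_seq [in X in (_ <= X)%N]big_seq; apply: leq_sum => k kF.
  have [lo hi] := lvP _ kF.
  apply: (count_near (fx := fx) sysD) => //.
  - move=> w wD; exact: (bndK _ (word_stable stK wD Kp0)).
  - by rewrite Llv /= leq_bigmax_seq.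
  - apply: le_trans lo; rewrite ler_pM2r ?rF // ler_nat.
    by rewrite trunc_logP // expn_gt0 m0.
have DP : 0 < (size D)%:R ^+ P :> R by rewrite exprn_gt0 // ltr0n.
rewrite -div1r ler_pdivrMr // -(ler_pM2l DP) mulr1.
move: step; rewrite -(ler_nat R) natrX => /le_trans; apply.
rewrite natr_sum mulr_suml mulr_sumr big_seq [leRHS]big_seq.
apply: ler_sum => k kF; have [lo hi] := lvP _ kF.
have lvPk : (lv k <= P)%N by rewrite leq_bigmax_seq.
have := @uniform_level_bound t (lv k) (L k) s (r k) t0 s0 (rF _ kF) tD
  (trunc_log_ltn _ n1) (Llv k) hi.
rewrite natrM natrM (natrX R (size D)) => le_t.
rewrite -(subnKC lvPk) exprD (subnKC lvPk) /A.
have -> : (size D)%:R ^+ lv k * (size D)%:R ^+ (P - lv k) *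
   (r k `^ s * (C%:R * (t%:R * m%:R `^ s))) =
  C%:R * (((size D)%:R ^+ lv k * (t%:R * m%:R `^ s) * r k `^ s) *
          (size D)%:R ^+ (P - lv k)) :> R by ring.
by rewrite ler_wpM2l // ler_wpM2r // exprn_ge0.
Qed.

End Uniform.

(** * Lower bound in general *)

(** With [N + 1 = l ^ 2] and [l * ln x >= 4 p], one has [p ln (N + 1) = 2 p ln l <= 2 p l <= (l ^ 2
    / 2) ln x <= N ln x]. *)
Lemma poly_le_exp (R : realType) (p : nat) (x : R) : 1 < x ->
  exists2 N : nat, (0 < N)%N & N.+1%:R ^+ p <= x ^+ N.
Proof.
move=> x1; have lx : 0 < ln x by rewrite ln_gt0.
have [l l2 lP] : exists2 l : nat, (2 <= l)%N & 4 * p%:R <= l%:R * ln x.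
  exists (Num.trunc (4 * p%:R / ln x)).+2 => //.
  have /truncn_itv/andP[_ /ltW lo] : 0 <= 4 * p%:R / ln x.
    by rewrite divr_ge0 ?mulr_ge0 // ltW.
  by rewrite -ler_pdivrMr // (le_trans lo) // ler_nat.
have l0 : (0 < l)%N by apply: ltnW.
have l20 : (0 < l ^ 2)%N by rewrite expn_gt0 l0.
have x0 : 0 < x by apply: lt_trans x1.
exists (l ^ 2).-1.
  by rewrite -ltnS prednK // -[1%N](exp1n 2) ltn_exp2r.
rewrite prednK // -ler_ln ?posrE ?exprn_gt0 ?ltr0n //.
rewrite !lnXn ?ltr0n // natrX lnXn ?ltr0n //.
rewrite -[X in X <= _]mulr_natl -[X in _ <= X]mulr_natl -[X in _ * X <= _]mulr_natl.
rewrite -subn1 natrB // natrX.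
have l2R : 2%:R <= l%:R :> R by rewrite ler_nat.
have lnl : ln (l%:R : R) <= l%:R by rewrite ltW // ln_sublinear // ltr0n.
have : p%:R * (2 * ln (l%:R : R)) <= p%:R * (2 * l%:R).
  by rewrite ler_wpM2l // ler_pM2l.
have := ler_wpM2l (ler0n R l) lP.
have : 0 <= (l%:R ^+ 2 - 2) * ln x by rewrite mulr_ge0 ?(ltW lx) //; nra.
nra.
Qed.

Lemma sum_le_size_max (R : realType) (T : eqType) (V : seq T) (F : T -> R) :
  (0 < size V)%N ->
  exists2 v, v \in V & \sum_(u <- V) F u <= (size V)%:R * F v.
Proof.
elim: V => // a [|b V] IH _.
  by exists a; rewrite ?mem_head // big_seq1 mul1r.
have [v vV sumV] := IH isT; rewrite big_cons.
have [Fav|/ltW Fva] := leP (F a) (F v).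
  exists v; first by rewrite inE vV orbT.
  by rewrite [size _]/= -natr1 mulrDl mul1r addrC lerD.
exists a; first exact: mem_head.
rewrite [size _]/= -natr1 mulrDl mul1r addrC lerD // (le_trans sumV) //.
by rewrite ler_wpM2l.
Qed.

Lemma prod_count (T : Type) (q : nat) (t : T -> nat) (w : seq T) :
  (forall a, t a <= q)%N ->
  (\prod_(a <- w) t a = \prod_(c < q.+1) c ^ count (fun a => t a == c) w)%N.
Proof.
move=> tq; elim: w => [|a w IH] /=.
  by rewrite big_nil big1 // => c _; rewrite expn0.
rewrite big_cons; under [RHS]eq_bigr => c _ do rewrite expnD.
rewrite big_split /= -IH; congr (_ * _)%N.
have ta : (t a < q.+1)%N by rewrite ltnS.
rewrite (bigD1 (Ordinal ta)) //= eqxx expn1 big1 ?muln1 // => c.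
by rewrite -val_eqE /= eq_sym => /negbTE ->; rewrite expn0.
Qed.

(** The product depends only on how often each value in [0..q] occurs among the factors: [q + 1]
    multiplicities, each at most [N]. *)
Lemma size_prod_words (T : eqType) (D : seq T) (N q : nat) (t : T -> nat) :
  (forall a, t a <= q)%N ->
  (size (undup [seq \prod_(a <- w) t a | w <- words D N]) <= N.+1 ^ q.+1)%N.
Proof.
move=> tq.
pose F (f : {ffun 'I_q.+1 -> 'I_N.+1}) := (\prod_(c < q.+1) c ^ f c)%N.
have <- : size (codom F) = (N.+1 ^ q.+1)%N.
  by rewrite size_codom card_ffun !card_ord.
apply: uniq_leq_size; first exact: undup_uniq.
move=> v; rewrite mem_undup => /mapP[w]; rewrite mem_words => /andP[/eqP sw _] ->.
apply/codomP; exists [ffun c : 'I_q.+1 => inord (count (fun a => t a == c) w)].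
rewrite /F (prod_count _ tq); apply: eq_bigr => c _.
by rewrite ffunE inordK // ltnS -sw count_size.
Qed.

Lemma powR_prodn (R : realType) (T : Type) (w : seq T) (t : T -> nat) (b : R) :
  (\prod_(a <- w) t a)%:R `^ b = \prod_(a <- w) ((t a)%:R `^ b) :> R.
Proof.
elim: w => [|a w IH]; first by rewrite !big_nil powR1.
by rewrite !big_cons natrM powRM // IH.
Qed.

Section Lower.
Variables (R : realType) (T : eqType) (n m : nat) (D : seq T).
Variables (col row : T -> nat) (fx fy : T -> bool).
Hypothesis sysD : row_system n m D col row fy.
Hypothesis mn : (1 < m < n)%N.

Let t (a : T) : nat := fibre D row (row a).

Definition block (N v : nat) : seq (seq T) :=
  [seq w <- words D N | (\prod_(a <- w) t a)%N == v].

Lemma mem_block (N v : nat) (w : seq T) : w \in block N v ->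
  [/\ size w = N, {subset w <= D} & (\prod_(a <- w) t a)%N = v].
Proof.
by rewrite mem_filter mem_words => /andP[/eqP <- /andP[/eqP -> /allP wD]].
Qed.

Lemma block_system (N v : nat) :
  row_system (n ^ N) (m ^ N) (block N v)
    (word_pos n col fx) (word_pos m row fy) (word_flip fy).
Proof.
case: (sysD) => uD lt inj fyr; split.
- by rewrite filter_uniq // words_uniq.
- by move=> w /mem_block[<- wD _]; split; apply/word_pos_lt/allP => a /wD /lt[].
- move=> w z /mem_block[sw wD _] /mem_block[sz zD _] colE rowE.
  apply: (word_inj sysD wD zD _ colE).
  by apply: (row_word_inj sysD wD zD _ rowE); rewrite sw sz.
- move=> w z /mem_block[sw wD _] /mem_block[sz zD _] rowE.
  have {rowE} : map row w = map row z.
    by apply: (row_word_inj sysD wD zD _ rowE); rewrite sw sz.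
  elim: w z wD zD {sw sz} => [|a w IH] [|c z] //= wD zD [rac rwz].
  have aD : a \in D by apply: wD; rewrite mem_head.
  have cD : c \in D by apply: zD; rewrite mem_head.
  rewrite (fyr a c) // (IH z) // => x xs; first by apply: wD; rewrite inE xs orbT.
  by apply: zD; rewrite inE xs orbT.
Qed.

Lemma block_stable (K : set (R * R)) (N v : nat) :
  stable n m D col row fx fy K ->
  stable (n ^ N) (m ^ N) (block N v) (word_pos n col fx) (word_pos m row fy)
    (word_flip fx) (word_flip fy) K.
Proof.
case: (sysD) => _ lt _ _; case/andP: mn => m1 ltmn.
move=> stK w /mem_block[<- wD _] p Kp; rewrite -!word_mapE.
- exact: word_stable stK wD Kp.
- exact: ltnW.
- by apply/allP => a /wD /lt[].
- exact: ltnW (ltn_trans m1 ltmn).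
- by apply/allP => a /wD /lt[].
Qed.

(** The weak position determines the word of rows, and the product of row sizes depends on that word
    alone. So a block contains all words of a row it meets, and their number is that product, namely
    [v]. *)
Lemma fibre_block (N v : nat) :
  {in block N v, forall w,
    fibre (block N v) (word_pos m row fy) (word_pos m row fy w) = v}.
Proof.
case: (sysD) => uD lt inj fyr w /mem_block[sw wD wv].
have := count_words row uD wD (_ : 0 <= size w <= size w)%N.
rewrite leqnn drop0 take_size subnn muln1 => /(_ isT).
rewrite -/t [X in _ = X -> _]wv sw => cntE; rewrite -[RHS]cntE /fibre count_filter.
apply: eq_in_count => z; rewrite mem_words => /andP[/eqP sz /allP zD] /=.
have -> : take N z = z by rewrite -sz take_size.
rewrite !take0 eqxx /=.
apply/andP/eqP => [[/eqP posE _]|rowE].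
  by apply: (row_word_inj sysD zD wD _ posE); rewrite sw sz.
split.
  apply/eqP; move: rowE; have := sz; rewrite -sw.
  elim: z w wD zD {sw sz wv cntE} => [|a z IH] [|c w] //= wD zD [szw] [rac rwz].
  have aD : a \in D by apply: zD; rewrite mem_head.
  have cD : c \in D by apply: wD; rewrite mem_head.
  rewrite (fyr a c) // rac szw (IH w) // => x xs.
    by apply: wD; rewrite inE xs orbT.
  by apply: zD; rewrite inE xs orbT.
have tE u : (\prod_(a <- u) t a = \prod_(j <- map row u) fibre D row j)%N.
  by rewrite big_map.
by rewrite tE rowE -tE wv eqxx.
Qed.

(** Grouping the expansion of [M ^ N] by products of row sizes leaves at most [(N + 1) ^ (|D| + 1)]
    terms. The largest is at least [M ^ N] divided by this polynomial, and the strict inequality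
    [m ^ s < M] absorbs the polynomial for a suitable [N]. *)
Lemma block_pigeonhole (s : R) :
  (0 < size D)%N -> m%:R `^ s < \sum_(a <- D) (t a)%:R `^ (beta R n m - 1) ->
  exists N v, [/\ (0 < N)%N, (0 < size (block N v))%N &
    (m ^ N)%:R `^ s * v%:R `^ (1 - beta R n m) <= (size (block N v))%:R].
Proof.
set M := \sum_(a <- D) _ => D0 sM; case/andP: (mn) => m1 ltmn.
set b := beta R n m in M sM *.
have m0 : 0 < m%:R :> R by rewrite ltr0n ltnW.
have ms0 : 0 < m%:R `^ s by apply: powR_gt0.
have t0 a : a \in D -> (0 < t a)%N.
  by move=> aD; rewrite /t /fibre -has_count; apply/hasP; exists a => /=.
have /(poly_le_exp (size D).+1)[N N0 polyN] : 1 < M / m%:R `^ s.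
  by rewrite ltr_pdivlMr // mul1r.
set V := undup [seq \prod_(a <- w) t a | w <- words D N]%N.
have V0 : (0 < size V)%N.
  have [a aD] : exists a, a \in D.
    by case: (D) D0 => // a ? _; exists a; rewrite mem_head.
  have wa : nseq N a \in words D N.
    by rewrite mem_words size_nseq eqxx; apply/allP => x /nseqP[->].
  have : (\prod_(c <- nseq N a) t c)%N \in V by rewrite mem_undup map_f.
  by case: V.
have sumM : M ^+ N = \sum_(v <- V) (size (block N v))%:R * v%:R `^ (b - 1).
  rewrite -sum_words_prod.
  under eq_bigr => w _ do rewrite -powR_prodn.
  rewrite (sum_undup_map (words D N) (fun w => \prod_(a <- w) t a)%N
    (fun v => v%:R `^ (b - 1))).
  by apply: eq_bigr => v _; rewrite size_filter.
have [v vV] := sum_le_size_max (fun v => (size (block N v))%:R * v%:R `^ (b - 1)) V0.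
rewrite -sumM => leM.
have [w ww vE] : exists2 w, w \in words D N & v = (\prod_(a <- w) t a)%N.
  by move: vV; rewrite mem_undup => /mapP[w ww ->]; exists w.
have v0 : 0 < v%:R :> R.
  rewrite ltr0n vE big_seq prodn_cond_gt0 // => a aw; apply: t0.
  by move: ww; rewrite mem_words => /andP[_ /allP]; apply.
exists N, v; split=> //.
  by rewrite size_filter -has_count; apply/hasP; exists w => //; rewrite vE.
have SV : (size V)%:R <= N.+1%:R ^+ (size D).+1 :> R.
  rewrite -natrX ler_nat; apply: size_prod_words => a.
  exact: count_size.
have V0R : 0 < (size V)%:R :> R by rewrite ltr0n.
have MN : (size V)%:R * (m%:R `^ s) ^+ N <=
    (size V)%:R * ((size (block N v))%:R * v%:R `^ (b - 1)).
  apply: le_trans leM.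
  apply: (@le_trans _ _ ((M / m%:R `^ s) ^+ N * (m%:R `^ s) ^+ N)).
    by rewrite ler_wpM2r ?exprn_ge0 ?(ltW ms0) // (le_trans SV).
  by rewrite -exprMn divfK // gt_eqF.
move: MN; rewrite ler_pM2l // -powR_mulrn ?powR_ge0 // -powRrM mulrC powRrM.
rewrite powR_mulrn ?ler0n // natrX -(opprB 1 b) powRN -ler_pdivlMr ?powR_gt0 //.
Qed.

(** [K] is stable under the maps of the chosen block, a system with rows of equal size, and [beta]
    is unchanged when [n] and [m] are raised to the power [N]. *)
Lemma carpet_cover_lower (K : set (R * R)) (p0 : R * R) (B : nat) (s : R) :
  stable n m D col row fx fy K -> K p0 ->
  (forall p, K p -> `|p.1| <= B%:R /\ `|p.2| <= B%:R) ->
  (0 < size D)%N -> 0 <= s ->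
  m%:R `^ s < \sum_(a <- D) (t a)%:R `^ (beta R n m - 1) ->
  exists2 c : R, 0 < c & forall (F : seq nat) (x : nat -> R * R) (r : nat -> R),
    {in F, forall k, 0 < r k} ->
    (forall p, K p -> exists2 k, k \in F &
       `|p.1 - (x k).1| < r k /\ `|p.2 - (x k).2| < r k) ->
    c <= \sum_(k <- F) r k `^ s.
Proof.
move=> stK Kp0 bndK D0 s0 /(block_pigeonhole D0)[N [v [N0 block0 le_v]]].
case/andP: (mn) => m1 ltmn; have n1 := ltn_trans m1 ltmn.
have mnN : (1 < m ^ N < n ^ N)%N.
  by rewrite ltn_exp2r // ltmn andbT (leq_trans m1) // -{1}(expn1 m) leq_exp2l.
have betaN : beta R (n ^ N) (m ^ N) = beta R n m.
  have lnX k : (1 < k)%N -> ln ((k ^ N)%:R : R) = ln k%:R * N%:R.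
    by move=> k1; rewrite natrX lnXn ?mulr_natr // ltr0n ltnW.
  rewrite /beta (lnX _ m1) (lnX _ n1) -mulf_div divff ?mulr1 //.
  by rewrite pnatr_eq0 -lt0n.
apply: (uniform_cover_lower (block_system N v) mnN (block_stable stK) Kp0) => //.
- exact: bndK.
- exact: fibre_block.
- by rewrite betaN.
Qed.

End Lower.

(** * Upper bound *)

Lemma prod_powR_expR (R : realType) (T : eqType) (w : seq T) (F : T -> R) (x : R) :
  {in w, forall a, 0 < F a} ->
  \prod_(a <- w) F a `^ x = expR (x * \sum_(a <- w) ln (F a)).
Proof.
elim: w => [|a w IH] F0; first by rewrite !big_nil mulr0 expR0.
rewrite !big_cons IH => [|c cw]; last by apply: F0; rewrite inE cw orbT.
by rewrite /powR gt_eqF ?F0 ?mem_head // mulrDr expRD.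
Qed.

Lemma word_map_dist (R : realType) (T : Type) (b : nat) (i : T -> nat)
    (f : T -> bool) (w : seq T) (x y : R) :
  `|word_map b i f w x - word_map b i f w y| = `|x - y| / (b ^ size w)%:R.
Proof.
elim: w => [|a w IH] /=; first by rewrite expn0 divr1.
by rewrite flip_map_dist IH expnS natrM invfM [_^-1 * _]mulrC mulrA.
Qed.

Lemma expr_le_eventually (R : realType) (x e : R) : 0 <= x < 1 -> 0 < e ->
  exists N : nat, forall k, (N <= k)%N -> x ^+ k <= e.
Proof.
move=> /andP[x0 x1] e0.
have /cvgr0_norm_le/(_ e e0)[N _ NP] : x ^+ k @[k --> \oo] --> 0.
  by apply: cvg_expr; rewrite ger0_norm.
exists N => k /NP /=; exact: le_trans (ler_norm _).
Qed.

Lemma eucl_dist_le (R : realType) (p q : R * R) :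
  eucl_dist p q <= `|p.1 - q.1| + `|p.2 - q.2|.
Proof.
rewrite -[leRHS]ger0_norm ?addr_ge0 // -sqrtr_sqr ler_wsqrtr //.
rewrite -[(p.1 - q.1) ^+ 2]real_normK ?num_real //.
rewrite -[(p.2 - q.2) ^+ 2]real_normK ?num_real // sqrrD.
by rewrite lerD2r lerDl mulrn_wge0 // mulr_ge0.
Qed.

Section Upper.
Variables (R : realType) (T : eqType) (n m : nat) (D : seq T).
Variables (col row : T -> nat) (fx fy : T -> bool).
Hypothesis sysD : row_system n m D col row fy.
Hypothesis mn : (1 < m < n)%N.

Let b : R := beta R n m.
Let t (j : nat) : R := (fibre D row j)%:R.
Let rows : seq nat := undup (map row D).
Let M : R := \sum_(a <- D) t (row a) `^ (b - 1).

Let m1 : (1 < m)%N. Proof. by case/andP: mn. Qed.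
Let n1 : (1 < n)%N. Proof. by case/andP: mn => ? ; exact: ltn_trans. Qed.
Let m0 : (0 < m)%N. Proof. exact: ltnW. Qed.
Let n0 : (0 < n)%N. Proof. exact: ltnW. Qed.
Let b0 : 0 < b. Proof. exact: beta_gt0. Qed.

Lemma fibre_ge1 (a : T) : a \in D -> 1 <= t (row a).
Proof.
by move=> aD; rewrite ler1n /fibre -has_count; apply/hasP; exists a => /=.
Qed.

Lemma sum_rows : \sum_(j <- rows) t j `^ b = M.
Proof.
rewrite /M (sum_undup_map D row (fun j => t j `^ (b - 1))) big_seq [RHS]big_seq.
apply: eq_bigr => j; rewrite mem_undup => /mapP[a aD ->].
by rewrite mulrC -mulr_powRB1 ?beta_gt0 // mulrC.
Qed.

(** Divided by [M ^ (size u + size v)], this is the mass of the approximate square under the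
    Bernoulli measure giving a digit in row [j] the mass [t j ^ (b - 1) / M]. *)
Definition square_weight (u : seq T) (v : seq nat) : R :=
  (\prod_(a <- u) t (row a) `^ (b - 1)) * (\prod_(j <- v) t j `^ b).

Lemma sum_square_weight (L l : nat) :
  \sum_(u <- words D L) \sum_(v <- words rows l) square_weight u v = M ^+ (L + l).
Proof.
under eq_bigr => u _ do rewrite -mulr_sumr.
by rewrite -mulr_suml !sum_words_prod sum_rows exprD.
Qed.

Definition log_fibre (k : nat) (w : seq T) : R :=
  \sum_(a <- take k w) ln (t (row a)).

Lemma square_weightE (L k : nat) (w : seq T) : {subset w <= D} -> (L <= k)%N ->
  square_weight (take L w) (map row (drop L (take k w))) =
  expR (b * log_fibre k w - log_fibre L w).
Proof.
move=> wD Lk; have t_gt0 a : a \in D -> 0 < t (row a).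
  by move=> /fibre_ge1; apply: lt_le_trans.
rewrite /square_weight big_map !prod_powR_expR.
- rewrite -expRD; congr expR; rewrite /log_fibre.
  rewrite -[in RHS](cat_take_drop L (take k w)).
  rewrite big_cat /= !take_takel //; ring.
- by move=> a /mem_drop /mem_take /wD /t_gt0.
- by move=> a /mem_take /wD /t_gt0.
Qed.

Lemma log_fibre_ge0 (k : nat) (w : seq T) : {subset w <= D} -> 0 <= log_fibre k w.
Proof.
move=> wD; rewrite /log_fibre big_seq sumr_ge0 // => a /mem_take /wD /fibre_ge1.
exact: ln_ge0.
Qed.

Lemma log_fibre_le (k : nat) (w : seq T) : {subset w <= D} ->
  log_fibre k w <= k%:R * (size D)%:R.
Proof.
move=> wD; apply: (@le_trans _ _ (\sum_(a <- take k w) (size D)%:R)).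
  rewrite /log_fibre big_seq [leRHS]big_seq ler_sum // => a /mem_take /wD aD.
  apply: (@le_trans _ _ (t (row a))); last by rewrite ler_nat count_size.
  by rewrite ltW // ln_sublinear // (lt_le_trans _ (fibre_ge1 aD)).
rewrite big_const_seq count_predT iter_addr_0 -[X in X <= _]mulr_natl ler_wpM2r //.
by rewrite ler_nat size_take; case: ltnP => // /ltnW.
Qed.

(* Consecutive scales [l], [k] serve as digit depth and row depth of one
   approximate square: [k] is least with [n ^ l <= m ^ k]. *)
Definition scale (k0 i : nat) : nat := iter i (fun l => up_log m (n ^ l)) k0.

(** Minimality of [up_log] gives the last bound; it requires [n ^ l > 1], hence a positive starting
    scale. *)
Lemma scaleP (k0 i : nat) : (0 < k0)%N ->
  [/\ (k0 <= scale k0 i)%N, (scale k0 i <= scale k0 i.+1)%N,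
      (n ^ scale k0 i <= m ^ scale k0 i.+1)%N &
      (m ^ scale k0 i.+1 <= m * n ^ scale k0 i)%N].
Proof.
move=> k00.
have step l : (0 < l)%N -> [/\ (l <= up_log m (n ^ l))%N,
    (n ^ l <= m ^ up_log m (n ^ l))%N & (m ^ up_log m (n ^ l) <= m * n ^ l)%N].
  move=> l0; have nl : (1 < n ^ l)%N by rewrite -(expn0 n) ltn_exp2l.
  have up := up_logP (n ^ l) m1.
  have lo := up_log_gtn m1 nl.
  have u0 : (0 < up_log m (n ^ l))%N by rewrite up_log_gt0 m1.
  split=> //.
    rewrite -(@leq_exp2l m) //; apply: leq_trans up.
    by case/andP: mn => _ /ltnW ?; rewrite leq_exp2r.
  by rewrite -(prednK u0) expnS leq_pmul2l // ltnW.
have sc0 : forall j, (k0 <= scale k0 j)%N.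
  by elim=> //= j IH; case: (step (scale k0 j)) => [|/(leq_trans IH)]; first lia.
by have [] := step (scale k0 i) (leq_trans k00 (sc0 i)); split.
Qed.

Lemma scale_le (k0 i j : nat) : (0 < k0)%N -> (i <= j)%N ->
  (scale k0 i <= scale k0 j)%N.
Proof.
move=> k00; elim: j => [|j IH]; first by rewrite leqn0 => /eqP ->.
rewrite leq_eqVlt => /predU1P[->//|]; rewrite ltnS => /IH/leq_trans; apply.
by case: (scaleP j k00).
Qed.

(* Otherwise the mean log-fibre would drop by [e] along every pair of
   consecutive scales and become negative. *)
Lemma good_scale (k0 N : nat) (e : R) (w : seq T) :
  (0 < k0)%N -> {subset w <= D} -> 0 < e -> (size D)%:R < N%:R * e ->
  exists2 i : nat, (i < N)%N &
    - e * (scale k0 i.+1)%:R <=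
    b * log_fibre (scale k0 i.+1) w - log_fibre (scale k0 i) w.
Proof.
move=> k00 wD e0 Ne; apply: contrapT => none.
pose mean i := log_fibre (scale k0 i) w / (scale k0 i)%:R.
have sc_gt0 i : 0 < (scale k0 i)%:R :> R.
  by rewrite ltr0n (leq_trans k00) //; case: (scaleP i k00).
have drop_mean i : (i < N)%N -> mean i.+1 <= mean i - e.
  move=> iN; rewrite leNgt; apply/negP => lt_mean; apply: none.
  exists i => //; have [_ _ nm _] := scaleP i k00.
  have := nm; rewrite -(ler_Mbeta R _ _ mn) -/b => lb.
  have fL : log_fibre (scale k0 i) w = mean i * (scale k0 i)%:R.
    by rewrite divfK // gt_eqF.
  have fk : log_fibre (scale k0 i.+1) w = mean i.+1 * (scale k0 i.+1)%:R.
    by rewrite divfK // gt_eqF.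
  have mean0 : 0 <= mean i by rewrite divr_ge0 ?log_fibre_ge0.
  have b1 : b <= 1 by rewrite ltW // beta_lt1.
  rewrite fL fk.
  (* With [L], [k] the two scales: [h1] uses [L <= b k], [h2] the assumed failure of the drop, and
     [h3] replaces the loss [b e k] by [e k]. *)
  have h1 : 0 <= mean i * (b * (scale k0 i.+1)%:R - (scale k0 i)%:R).
    by rewrite mulr_ge0 // subr_ge0.
  have h2 : 0 <= (mean i.+1 - (mean i - e)) * (b * (scale k0 i.+1)%:R).
    by apply: mulr_ge0; [rewrite subr_ge0 ltW|rewrite mulr_ge0 // ltW].
  have h3 : 0 <= (1 - b) * e * (scale k0 i.+1)%:R.
    by apply: mulr_ge0 => //; apply: mulr_ge0; [rewrite subr_ge0|exact: ltW].
  nra.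
have mean_le i : (i <= N)%N -> mean i <= mean 0 - i%:R * e.
  elim: i => [|i IH] iN; first by rewrite mul0r subr0.
  have := drop_mean _ iN; have := IH (ltnW iN).
  by rewrite -natr1 mulrDl mul1r; lra.
have := mean_le N (leqnn _).
have : 0 <= mean N by rewrite divr_ge0 ?log_fibre_ge0.
have : mean 0 <= (size D)%:R by rewrite ler_pdivrMr // mulrC log_fibre_le.
lra.
Qed.

(** * Approximate squares in the carpet and the efficient cover *)

Variable K : set (R * R).
Hypothesis stK : stable n m D col row fx fy K.
Hypothesis decK : forall p, K p -> exists a q, [/\ a \in D, K q &
  p = (flip_map n (fx a) (col a) q.1, flip_map m (fy a) (row a) q.2)].
Variable B : nat.
Hypothesis bndK : forall p, K p -> `|p.1| <= B%:R /\ `|p.2| <= B%:R.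

Lemma word_decomposition (k : nat) (p : R * R) : K p -> exists w q,
  [/\ w \in words D k, K q &
      p = (word_map n col fx w q.1, word_map m row fy w q.2)].
Proof.
elim: k p => [|k IH] p Kp; first by exists [::], p; split=> //; case: p Kp.
have [a [q [aD Kq ->]]] := decK Kp; have [w [q' [ww Kq' ->]]] := IH q Kq.
by exists (a :: w), q'; split=> //; apply/allpairsP; exists (a, w).
Qed.

Definition square (u : seq T) (v : seq nat) : set (R * R) :=
  [set p | exists w q, [/\ {subset u ++ w <= D}, map row w = v, K q &
    p = (word_map n col fx (u ++ w) q.1, word_map m row fy (u ++ w) q.2)]].

(** Constancy of the weak sign on rows enters here: the rows alone determine the weak coordinate
    map. *)
Lemma word_map_row_eq (w z : seq T) (x : R) :
  {subset w <= D} -> {subset z <= D} -> map row w = map row z ->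
  word_map m row fy w x = word_map m row fy z x.
Proof.
case: (sysD) => _ _ _ fyr.
elim: w z => [|a w IH] [|c z] //= wD zD [rac rwz].
have aD : a \in D by apply: wD; rewrite mem_head.
have cD : c \in D by apply: zD; rewrite mem_head.
rewrite rac (fyr a c) // (IH z) // => y ys; first by apply: wD; rewrite inE ys orbT.
by apply: zD; rewrite inE ys orbT.
Qed.

(** Horizontally the common prefix [u] contracts by [n ^ size u], which is [m ^ k] up to a factor
    [m]; vertically equal rows give the same map, contracting by [m ^ k]. The two parts sum to
    [2 B (m + 1) / m ^ k]. *)
Lemma square_dist (u : seq T) (v : seq nat) (p q : R * R) :
  (m ^ (size u + size v) <= m * n ^ size u)%N ->
  square u v p -> square u v q ->
  eucl_dist p q <= (B.*2 * m.+1)%:R / (m ^ (size u + size v))%:R.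
Proof.
move=> mnu [w [p' [uwD wv Kp' ->]]] [z [q' [uzD zv Kq' ->]]].
apply: le_trans (eucl_dist_le _ _) _ => /=.
have sv (y : seq T) : map row y = v -> size y = size v.
  by move=> <-; rewrite size_map.
have dist2B (x y : R) : `|x| <= B%:R -> `|y| <= B%:R -> `|x - y| <= (B.*2)%:R.
  move=> xB yB; rewrite (le_trans (ler_normB _ _)) // -addnn natrD lerD //.
have mk0 : 0 < (m ^ (size u + size v))%:R :> R by rewrite ltr0n expn_gt0 m0.
rewrite natrM -natr1 mulrDr mulr1 mulrDl lerD //.
  rewrite !word_map_cat word_map_dist.
  have zD : {subset z <= D} by move=> x xz; apply: uzD; rewrite mem_cat xz orbT.
  have wD : {subset w <= D} by move=> x xw; apply: uwD; rewrite mem_cat xw orbT.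
  have [+ _] := bndK (word_stable stK wD Kp').
  have [+ _] := bndK (word_stable stK zD Kq') => /= qB pB.
  rewrite ler_pdivrMr ?ltr0n ?expn_gt0 ?n0 // -[leRHS]mulrA -[leRHS]mulrA.
  rewrite -[leLHS]mulr1; apply: ler_pM => //; first exact: dist2B.
  by rewrite mulrCA -natrM mulrC ler_pdivlMr // mul1r ler_nat.
rewrite (@word_map_row_eq (u ++ w) (u ++ z)) //; last by rewrite !map_cat wv zv.
rewrite word_map_dist size_cat (sv _ zv) ler_wpM2r ?invr_ge0 ?(ltW mk0) //.
by apply: dist2B; [case: (bndK Kp')|case: (bndK Kq')].
Qed.

(** Markov's inequality: the weights sum to [M ^ (L + l)], and every counted square weighs at least
    [lam ^ (L + l)]. *)
Lemma sum_good_squares (L l : nat) (lam x : R) : 0 < lam -> 0 <= x ->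
  \sum_(i <- [seq (u, v) | u <- words D L, v <- words rows l] |
         lam ^+ (L + l) <= square_weight i.1 i.2) x <= x * (M / lam) ^+ (L + l).
Proof.
move=> lam0 x0; set J := [seq (u, v) | u <- words D L, v <- words rows l].
have lamk : 0 < lam ^+ (L + l) by rewrite exprn_gt0.
have w0 u v : 0 <= square_weight u v.
  by rewrite mulr_ge0 // prodr_ge0 // => ? _; apply: powR_ge0.
apply: (@le_trans _ _
    (\sum_(i <- J) x * (square_weight i.1 i.2 / lam ^+ (L + l)))).
  rewrite big_mkcond; apply: ler_sum => i _; case: ifP => [good|_].
    by rewrite ler_peMr // ler_pdivlMr // mul1r.
  by rewrite mulr_ge0 // divr_ge0 // ltW.
rewrite -mulr_sumr -mulr_suml big_allpairs_dep /= sum_square_weight.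
by rewrite expr_div_n.
Qed.

(** The cover collects the heavy squares of [N] consecutive scales from [k0] on. Their contribution
    at scale [k] is at most [C ^ s * (x / lam) ^ k], and [N] does not depend on [k0], so a large
    [k0] makes the sum small. *)
Lemma carpet_cover_upper (s delta eta : R) :
  (0 < size D)%N -> 0 <= s -> M < m%:R `^ s -> 0 < delta -> 0 < eta ->
  exists (J : seq (seq T * seq nat)) (d : seq T * seq nat -> R),
  [/\ {in J, forall i, 0 <= d i <= delta},
      {in J, forall i p q, square i.1 i.2 p -> square i.1 i.2 q ->
         eucl_dist p q <= d i},
      (forall p, K p -> exists2 i, i \in J & square i.1 i.2 p) &
      \sum_(i <- J) d i `^ s <= eta].
Proof.
move=> D0 s0 Ms delta0 eta0.
have m0R : 0 < m%:R :> R by rewrite ltr0n.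
have ms0 : 0 < m%:R `^ s by apply: powR_gt0.
have M0 : 0 <= M by rewrite sumr_ge0 // => a _; apply: powR_ge0.
set x := M / m%:R `^ s.
have x0 : 0 <= x by rewrite divr_ge0 // ltW.
have x1 : x < 1 by rewrite ltr_pdivrMr // mul1r.
(* Any [lam] strictly between [x] and 1 works: [lam < 1] yields a positive drop [- ln lam], and
   [x < lam] yields geometric decay. *)
pose lam := (1 + x) / 2.
have lam1 : lam < 1 by rewrite /lam; lra.
have xlam : x < lam by rewrite /lam; lra.
have lam0 : 0 < lam by apply: le_lt_trans xlam.
have e0 : 0 < - ln lam by rewrite oppr_gt0 ln_lt0 // lam0.
have [N Ne] : exists N : nat, (size D)%:R < N%:R * - ln lam.
  exists (Num.trunc ((size D)%:R / - ln lam)).+1.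
  have /truncn_itv/andP[_] : 0 <= (size D)%:R / - ln lam by rewrite divr_ge0 // ltW.
  by rewrite ltr_pdivrMr.
pose C : R := (B.*2 * m.+1)%:R.
(* Adding 1 keeps the denominators positive even when [N] or [C] vanishes. *)
have [N1 N1P] : exists N1 : nat, forall k, (N1 <= k)%N ->
    (x / lam) ^+ k <= eta / (N%:R * C `^ s + 1).
  apply: expr_le_eventually.
    by rewrite divr_ge0 ?(ltW lam0) //= ltr_pdivrMr // mul1r.
  by rewrite divr_gt0 // ltr_wpDl // mulr_ge0 // powR_ge0.
have [N2 N2P] : exists N2 : nat, forall k, (N2 <= k)%N ->
    (m%:R^-1) ^+ k <= delta / (C + 1).
  apply: expr_le_eventually; last by rewrite divr_gt0 // ltr_wpDl.
  by rewrite invr_ge0 ltW //= invf_lt1 // ltr1n.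
have [k0 [k00 N1k0 N2k0]] : exists k0, [/\ 0 < k0, N1 <= k0 & N2 <= k0]%N.
  by exists (N1 + N2).+1; split; rewrite ?ltnS ?leqW ?leq_addr ?leq_addl.
pose sc := scale k0.
pose good i (w : seq T * seq nat) := lam ^+ sc i.+1 <= square_weight w.1 w.2.
pose Js i := [seq w <- [seq (u, v) | u <- words D (sc i),
                          v <- words rows (sc i.+1 - sc i)] | good i w].
have JsP i w : w \in Js i -> size w.1 = sc i /\ (size w.1 + size w.2 = sc i.+1)%N.
  rewrite mem_filter => /andP[_ /allpairsP[[u v] [/= + + ->]]] /=.
  rewrite !mem_words => /andP[/eqP -> _] /andP[/eqP -> _]; split=> //.
  by rewrite subnKC //; case: (scaleP i k00).
exists (flatten [seq Js i | i <- iota 0 N]),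
  (fun w => C / (m ^ (size w.1 + size w.2))%:R); split.
- move=> w /flatten_mapP[i _ /JsP[_ ->]].
  rewrite divr_ge0 //=; apply: (@le_trans _ _ (C * (delta / (C + 1)))).
    rewrite ler_wpM2l // natrX -exprVn N2P //.
    have [k0sc scsc _ _] := scaleP i k00.
    exact: leq_trans N2k0 (leq_trans k0sc scsc).
  rewrite mulrCA ler_piMr ?(ltW delta0) // ler_pdivrMr ?ltr_wpDl //.
  by rewrite mul1r lerDl.
- move=> w /flatten_mapP[i _ /JsP[sw1 sw2]] p q; apply: square_dist.
  by rewrite sw2 sw1; case: (scaleP i k00).
(* One coding of [p] down to the last scale serves all scales; [good_scale] selects the one whose
   square is heavy. *)
- move=> p /(word_decomposition (sc N))[w [q [+ Kq ->]]].
  rewrite mem_words => /andP[/eqP sw /allP wD].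
  have [i iN] := good_scale k00 wD e0 Ne; rewrite -/sc opprK => le_log.
  have scsc : (sc i <= sc i.+1)%N by case: (scaleP i k00).
  have scN : (sc i.+1 <= sc N)%N by apply: scale_le.
  set u := take (sc i) w; set z := drop (sc i) (take (sc i.+1) w).
  have uzE : u ++ z = take (sc i.+1) w.
    by rewrite /u -(take_takel w scsc) cat_take_drop.
  have uD : {subset u <= D} by move=> a /mem_take /wD.
  have zD : {subset z <= D} by move=> a /mem_drop /mem_take /wD.
  exists (u, map row z) => /=.
    apply/flatten_mapP; exists i; first by rewrite mem_iota.
    rewrite mem_filter; apply/andP; split.
      rewrite /good /= square_weightE // -[lam in X in X <= _]lnK ?posrE //.
      by rewrite -expRM_natr ler_expR.
    apply/allpairsP; exists (u, map row z); split=> //=; rewrite mem_words.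
      rewrite size_takel ?sw ?(leq_trans scsc) // eqxx.
      by apply/allP => a /uD.
    rewrite size_map size_drop size_takel ?sw // eqxx.
    by apply/allP => j /mapP[a /zD aD ->]; rewrite /= mem_undup map_f.
  exists z, (word_map n col fx (drop (sc i.+1) w) q.1,
             word_map m row fy (drop (sc i.+1) w) q.2); split=> //=.
  + by move=> a; rewrite mem_cat => /orP[/uD|/zD].
  + by apply: (word_stable stK _ Kq) => a /mem_drop /wD.
  + by rewrite -!word_map_cat uzE cat_take_drop.
rewrite big_flatten big_map.
apply: (@le_trans _ _ (\sum_(i <- iota 0 N) C `^ s * (x / lam) ^+ sc i.+1)).
  apply: ler_sum => i _; have [_ scsc _ _] := scaleP i k00.
  rewrite big_seq (eq_bigr (fun=> (C / (m ^ sc i.+1)%:R) `^ s)); last first.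
    by move=> w /JsP[_ ->].
  rewrite -big_seq big_filter.
  have := @sum_good_squares (sc i) (sc i.+1 - sc i) lam
    ((C / (m ^ sc i.+1)%:R) `^ s) lam0 (powR_ge0 _ _).
  rewrite subnKC // => /le_trans; apply.
  have -> : (C / (m ^ sc i.+1)%:R) `^ s = C `^ s / (m%:R `^ s) ^+ sc i.+1.
    rewrite powRM ?invr_ge0 // -powR_inv1 // -powRrM mulN1r powRN natrX.
    rewrite -(powR_mulrn _ (ler0n R m)) -powRrM [_ * s]mulrC powRrM.
    by rewrite powR_mulrn // powR_ge0.
  have -> : x / lam = (m%:R `^ s)^-1 * (M / lam) by rewrite /x mulrAC mulrC.
  by rewrite [in leRHS]exprMn exprVn mulrA.
apply: (@le_trans _ _ (\sum_(i <- iota 0 N) C `^ s * (eta / (N%:R * C `^ s + 1)))).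
  apply: ler_sum => i _; rewrite ler_wpM2l ?powR_ge0 // N1P //.
  have [k0sc scsc _ _] := scaleP i k00.
  exact: leq_trans N1k0 (leq_trans k0sc scsc).
rewrite big_const_seq count_predT size_iota iter_addr_0 -[X in X <= _]mulr_natl.
rewrite mulrA mulrCA ler_piMr ?(ltW eta0) // ler_pdivrMr.
  by rewrite mul1r lerDl.
by rewrite ltr_wpDl // mulr_ge0 // powR_ge0.
Qed.

End Upper.

(** * Hausdorff measure *)

Lemma normed_compact_cover (R : realType) (V : normedModType R) (A : set V) :
  compact A -> cover_compact A.
Proof. by rewrite compact_cover. Qed.

Section Hausdorff.
Variable R : realType.
Implicit Types (A K U : set (R * R)) (s : R).

Lemma eucl_dist_ge0 (p q : R * R) : 0 <= eucl_dist p q.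
Proof. exact: sqrtr_ge0. Qed.

Lemma eucl_dist_ge (p q : R * R) :
  `|p.1 - q.1| <= eucl_dist p q /\ `|p.2 - q.2| <= eucl_dist p q.
Proof.
by rewrite -!sqrtr_sqr; split; rewrite ler_wsqrtr // ?lerDl ?lerDr sqr_ge0.
Qed.

Lemma diam_ub U (p q : R * R) : U p -> U q -> ((eucl_dist p q)%:E <= diam U)%E.
Proof. by move=> Up Uq; apply: ereal_sup_ubound; exists p => //; exists q. Qed.

Lemma diam_ge0 U : U !=set0 -> (0 <= diam U)%E.
Proof.
by case=> p Up; apply: le_trans (diam_ub Up Up); rewrite lee_fin eucl_dist_ge0.
Qed.

Lemma diam_le U (d : R) :
  (forall p q, U p -> U q -> eucl_dist p q <= d) -> (diam U <= d%:E)%E.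
Proof.
by move=> Ud; apply: ge_ereal_sup => _ [p Up [q Uq <-]]; rewrite lee_fin Ud.
Qed.

Lemma diam_pow_ge0 s U : (0 <= diam_pow s U)%E.
Proof. by rewrite /diam_pow; case: ifP => // _; apply: poweR_ge0. Qed.

Lemma diam_fin U (d : R) : U !=set0 -> (diam U <= d%:E)%E ->
  exists2 e : R, 0 <= e <= d & diam U = e%:E.
Proof.
move=> /diam_ge0; case: (diam U) => [e| |] //; rewrite !lee_fin => e0 ed.
by exists e => //; rewrite e0.
Qed.

Lemma diam_pow_neq0 s U : U !=set0 -> diam_pow s U = (diam U `^ s)%E.
Proof.
by rewrite /diam_pow => U0; case: asboolP => // UE; rewrite UE in U0; case: U0.
Qed.

Lemma diam_pow0 s : diam_pow s (set0 : set (R * R)) = 0%E.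
Proof. by rewrite /diam_pow asboolT. Qed.

Lemma diam_pow_le s U (d : R) : 0 <= s -> (diam U <= d%:E)%E ->
  (diam_pow s U <= (d `^ s)%:E)%E.
Proof.
move=> s0 Ud; have [->|/set0P U0] := eqVneq U set0.
  by rewrite diam_pow0 lee_fin powR_ge0.
rewrite diam_pow_neq0 //; have [e /andP[e0 ed] ->] := diam_fin U0 Ud.
by rewrite poweR_EFin lee_fin ge0_ler_powR // nnegrE // (le_trans e0).
Qed.

Lemma sum_nth_le (F : set (R * R) -> \bar R) (Us : seq (set (R * R))) (N : nat) :
  F set0 = 0%E -> (forall U, (0 <= F U)%E) ->
  (\sum_(0 <= k < N) F (nth set0 Us k) <= \sum_(U <- Us) F U)%E.
Proof.
move=> F0 Fge; elim: Us N => [|U Us IH] N.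
  by rewrite big_nil big1 // => k _; rewrite nth_nil.
case: N => [|N]; first by rewrite big_geq // sume_ge0.
by rewrite big_nat_recl //= big_cons leeD.
Qed.

Lemma content_le_sum (J : eqType) (js : seq J) (U : J -> set (R * R)) (d : J -> R)
    s (delta : R) A :
  0 <= s -> {in js, forall i, d i <= delta} -> 0 < delta ->
  {in js, forall i p q, U i p -> U i q -> eucl_dist p q <= d i} ->
  (forall p, A p -> exists2 i, i \in js & U i p) ->
  (hausdorff_content s delta A <= (\sum_(i <- js) d i `^ s)%:E)%E.
Proof.
move=> s0 dd delta0 Ud cov.
pose V k := nth set0 (map U js) k.
apply: (@le_trans _ _ (\sum_(0 <= k <oo) diam_pow s (V k))%E).
  apply: ereal_inf_lbound; exists V => //; split.
    move=> p /cov[i ij Up]; exists (index i js) => //.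
    by rewrite /V (nth_map i) ?index_mem // nth_index.
  move=> k; have [kj|jk] := ltnP k (size js); last first.
    rewrite /V nth_default ?size_map //.
    by apply: diam_le => p q [].
  have [i0 _] : exists i, i \in js.
    by case: (js) kj => // i l _; exists i; rewrite mem_head.
  rewrite /V (nth_map i0) //; apply: diam_le => p q Up Uq.
  have ij : nth i0 js k \in js by rewrite mem_nth.
  exact: le_trans (Ud _ ij _ _ Up Uq) (dd _ ij).
apply: lime_le.
  by apply: is_cvg_nneseries => k _ _; apply: diam_pow_ge0.
apply: nearW => N; apply: le_trans (sum_nth_le _ _ _ _) _.
- exact: diam_pow0.
- exact: diam_pow_ge0.
rewrite big_map -sumEFin big_seq [leRHS]big_seq; apply: lee_sum => i ij.
by apply: diam_pow_le => //; apply: diam_le => p q; apply: Ud.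
Qed.

Lemma content_ge0 s (delta : R) A : (0 <= hausdorff_content s delta A)%E.
Proof.
apply/ereal_infP => _ [U _ <-].
by apply: nneseries_ge0 => k _ _; apply: diam_pow_ge0.
Qed.

Lemma content_le_measure s (delta : R) A : 0 < delta ->
  (hausdorff_content s delta A <= hausdorff_measure s A)%E.
Proof. by move=> delta0; apply: ereal_sup_ubound; exists delta. Qed.

Lemma measure_eq0 s A :
  (forall delta eta : R, 0 < delta -> 0 < eta ->
     (hausdorff_content s delta A <= eta%:E)%E) ->
  hausdorff_measure s A = 0%E.
Proof.
move=> small; apply/eqP; rewrite eq_le; apply/andP; split.
  apply: ge_ereal_sup => _ [delta /= delta0 <-].
  by apply/lee_addgt0Pr => eta eta0; rewrite add0e small.
exact: le_trans (content_ge0 s 1 A) (content_le_measure s A ltr01).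
Qed.

Lemma sum_halves (eta : R) (N : nat) : 0 <= eta ->
  \sum_(0 <= k < N) eta / 2 ^+ k.+1 <= eta.
Proof.
move=> eta0; suff -> : \sum_(0 <= k < N) eta / 2 ^+ k.+1 = eta - eta / 2 ^+ N.
  by rewrite gerBl divr_ge0 // exprn_ge0.
elim: N => [|N IH]; first by rewrite big_geq // expr0 divr1 subrr.
rewrite big_nat_recr //= IH exprS; have : 2 ^+ N != 0 :> R by rewrite expf_neq0.
by move=> ?; field.
Qed.

(* Replacing each set by a ball of radius [(|U_k|^s + eta 2^-k-1)^(1/s')] keeps
   the [s']-sum small since [|U_k| <= 1] and [s < s']. *)
Lemma ball_cover_of_null K s s' (eta : R) :
  compact K -> 0 <= s < s' -> hausdorff_measure s K = 0%E -> 0 < eta ->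
  exists (F : seq nat) (x : nat -> R * R) (r : nat -> R),
  [/\ forall k, 0 < r k,
      (forall p, K p -> exists2 k, k \in F &
         `|p.1 - (x k).1| < r k /\ `|p.2 - (x k).2| < r k) &
      \sum_(k <- F) r k `^ s' <= eta *+ 2].
Proof.
move=> cK /andP[s0 ss'] null eta0; have s'0 : 0 < s' by apply: le_lt_trans ss'.
have : (hausdorff_content s 1 K < eta%:E)%E.
  by apply: le_lt_trans (content_le_measure s K ltr01) _; rewrite null lte_fin.
move=> /ereal_inf_lt[_ [U [covU dU] <-] ltU].
pose P k := fine (diam_pow s (U k)).
have Pfin k : diam_pow s (U k) = (P k)%:E.
  have := diam_pow_le s0 (dU k); have := diam_pow_ge0 s (U k).
  by rewrite /P; case: (diam_pow s (U k)).
have P0 k : 0 <= P k by rewrite -lee_fin -Pfin diam_pow_ge0.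
pose G k := P k + eta / 2 ^+ k.+1.
have G0 k : 0 < G k by rewrite ltr_wpDl // divr_gt0 // exprn_gt0.
pose r k := G k `^ s'^-1.
have r0 k : 0 < r k by apply: powR_gt0.
have rG k : r k `^ s' = G k.
  by rewrite /r -powRrM mulVf ?gt_eqF // powRr1 // ltW.
have /choice[x xU] : forall k, exists y, U k !=set0 -> U k y.
  move=> k; have [[y Uy]|none] := pselect (U k !=set0); first by exists y.
  by exists (0, 0).
have in_ball k p : U k p -> `|p.1 - (x k).1| < r k /\ `|p.2 - (x k).2| < r k.
  move=> Up; have U0 : U k !=set0 by exists p.
  have Ux := xU _ U0; have [d /andP[d0 d1] dE] := diam_fin U0 (dU k).
  have dr : d < r k.
    rewrite ltNge; apply/negP => rd.
    have : r k `^ s' <= d `^ s' by rewrite ge0_ler_powR ?nnegrE // ltW.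
    apply/negP; rewrite -ltNge rG; apply: (@le_lt_trans _ _ (P k)).
      have PE : P k = d `^ s.
        by apply: EFin_inj; rewrite -Pfin diam_pow_neq0 // dE poweR_EFin.
      rewrite PE; have [->|dneq0] := eqVneq d 0.
        by rewrite powR0 ?gt_eqF // powR_ge0.
      by rewrite ger_powR ?(ltW ss') // lt0r dneq0 d0.
    by rewrite /G ltrDl divr_gt0 // exprn_gt0.
  have pd : eucl_dist p (x k) <= d by rewrite -lee_fin -dE; apply: diam_ub.
  have [h1 h2] := eucl_dist_ge p (x k).
  by split; apply: le_lt_trans dr; apply: le_trans pd.
have covK := normed_compact_cover cK.
have [] := covK nat setT (fun k => ball (x k) (r k)) =>
    [k _|p /covU[k _ Up]|F _ covF].
- exact: ball_open.
- exists k => //; have [h1 h2] := in_ball _ _ Up.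
  by split; rewrite -ball_normE /= distrC.
pose Fs := undup (finmap.enum_fset F); exists Fs, x, r; split=> //.
  move=> p /covF[k /= kF [h1 h2]]; exists k; first by rewrite mem_undup.
  move: h1 h2; rewrite -!ball_normE /=.
  by rewrite [`|(x k).1 - _|]distrC [`|(x k).2 - _|]distrC.
have [N FsN] : exists N, forall k, k \in Fs -> k \in iota 0 N.
  exists (\max_(k <- Fs) k).+1 => k kF; rewrite mem_iota /= add0n ltnS.
  exact: leq_bigmax_seq.
apply: (@le_trans _ _ (\sum_(0 <= k < N) G k)).
  under eq_bigr => k _ do rewrite rG.
  rewrite (perm_big [seq k <- index_iota 0 N | k \in Fs]) /=; last first.
    apply: uniq_perm => [||k]; first exact: undup_uniq.
      by rewrite filter_uniq // iota_uniq.
    by rewrite mem_filter /index_iota subn0; case: (boolP (k \in Fs)) => // /FsN ->.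
  rewrite big_filter big_mkcond; apply: ler_sum => k _.
  by case: ifP => // _; apply: ltW.
rewrite big_split /= mulr2n lerD //; last by rewrite sum_halves // ltW.
rewrite -lee_fin -sumEFin; apply: le_trans (ltW ltU).
under eq_bigr => k _ do rewrite -Pfin.
by apply: nneseries_lim_ge => k _ _; apply: diam_pow_ge0.
Qed.

Lemma compact_sup_bound K : compact K -> exists B : nat,
  forall p, K p -> `|p.1| <= B%:R /\ `|p.2| <= B%:R.
Proof.
move=> /compact_bounded[M [_ MK]].
exists (Num.trunc (`|M| + 1)).+1 => p Kp.
have : `|p| <= `|M| + 1.
  by apply: MK => //; rewrite ltr_pwDr // ler_norm.
have /truncn_itv/andP[_ /ltW hi] : 0 <= `|M| + 1 by rewrite addr_ge0.
by move=> /le_trans/(_ hi); rewrite prod_normE ge_max => /andP[].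
Qed.

End Hausdorff.

(** * The carpet *)

Lemma sign_flip_map (R : realType) (s : int) (b k : nat) (x : R) : is_sign s ->
  (s%:~R * x + (sign_shift s k)%:R) / b%:R = flip_map b (s != 1) k x.
Proof.
rewrite /flip_map /sign_shift => -[] -> /=; first by rewrite mul1r addrC.
by rewrite mulN1r addrC.
Qed.

Section Carpet.
Variables (R : realType) (n m : nat) (D : {set 'I_n * 'I_m}).
Variables (sigma eta : 'I_n * 'I_m -> int).
Hypothesis mn : (1 < m < n)%N.
Hypothesis D0 : D <> finset.set0.
Hypothesis hsigma : forall d, d \in D -> is_sign (sigma d).
Hypothesis heta : forall d, d \in D -> is_sign (eta d).
Hypothesis rowc : row_constant D eta.

Let col (d : 'I_n * 'I_m) : nat := d.1.
Let row (d : 'I_n * 'I_m) : nat := d.2.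
Let fx (d : 'I_n * 'I_m) : bool := sigma d != 1.
Let fy (d : 'I_n * 'I_m) : bool := eta d != 1.

Lemma carpet_mapE (d : 'I_n * 'I_m) (p : R * R) : d \in D ->
  carpet_map sigma eta d p =
  (flip_map n (fx d) (col d) p.1, flip_map m (fy d) (row d) p.2).
Proof.
by move=> dD; rewrite /carpet_map !sign_flip_map //; [apply: heta|apply: hsigma].
Qed.

Lemma carpet_system : row_system n m (enum D) col row fy.
Proof.
split; first exact: enum_uniq.
- by move=> d _; split; apply: ltn_ord.
- by move=> [i j] [i' j'] _ _ ii' jj'; congr pair; apply: val_inj.
- move=> [i j] [i' j']; rewrite !mem_enum => dD dD' jj'.
  have {}jj' : j = j' by apply: val_inj.
  rewrite -{j'}jj' in dD' *; have idD : i \in digit_row D j by rewrite inE.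
  have [|e [_ eE]] := rowc (j := j).
    by move=> row0; rewrite row0 inE in idD.
  by rewrite /fy !eE // inE.
Qed.

Lemma fibre_enum (j : 'I_m) : fibre (enum D) row j = #|digit_row D j|.
Proof.
rewrite /fibre -sum1_count big_enum_cond -sum1_card.
rewrite (reindex_onto (fun i => (i, j)) fst) /=; last first.
  move=> [i j'] /andP[_ /eqP jj]; congr pair; apply: val_inj; exact: esym.
by apply: eq_bigl => i; rewrite !inE /row /= !eqxx !andbT.
Qed.

Lemma sum_carpet :
  \sum_(d <- enum D) (fibre (enum D) row (row d))%:R `^ (beta R n m - 1) =
  \sum_(j < m) #|digit_row D j|%:R `^ beta R n m.
Proof.
rewrite big_enum (partition_big snd xpredT) //=; apply: eq_bigr => j _.
rewrite (eq_bigr (fun=> #|digit_row D j|%:R `^ (beta R n m - 1))); last first.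
  by move=> d /andP[_ /eqP dj]; rewrite /row dj fibre_enum.
rewrite -(@mulr_powRB1 R _ (beta R n m)) ?beta_gt0 // sumr_const -[LHS]mulr_natl.
congr (_%:R * _); rewrite -fibre_enum /fibre -sum1_count big_enum_cond -sum1_card.
by apply: eq_bigl => d.
Qed.

Lemma sum_carpet_ge1 : 1 <= \sum_(j < m) #|digit_row D j|%:R `^ beta R n m :> R.
Proof.
have /set0Pn[[i j] dD] : D != finset.set0 by apply/eqP.
rewrite (bigD1 j) //= ler_wpDr //.
  by apply: sumr_ge0 => k _; apply: powR_ge0.
rewrite powR_ge1 ?(ltW (beta_gt0 _ mn)) // ler1n card_gt0.
by apply/set0Pn; exists i; rewrite inE.
Qed.

Lemma ltr_carpet_dim (s : R) :
  (s < carpet_dim R D) =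
  (m%:R `^ s < \sum_(j < m) #|digit_row D j|%:R `^ beta R n m).
Proof.
have [m1 _] := andP mn; have lnm := ln_nat_gt0 R m1.
rewrite /carpet_dim -ltr_pdivrMl ?invr_gt0 // invrK.
have S0 := lt_le_trans ltr01 sum_carpet_ge1.
by rewrite -[RHS]ltr_ln ?posrE ?powR_gt0 ?ltr0n ?(ltnW m1) // ln_powR mulrC.
Qed.

Lemma gtr_carpet_dim (s : R) :
  (carpet_dim R D < s) =
  (\sum_(j < m) #|digit_row D j|%:R `^ beta R n m < m%:R `^ s).
Proof.
have [m1 _] := andP mn; have lnm := ln_nat_gt0 R m1.
rewrite /carpet_dim -ltr_pdivlMl ?invr_gt0 // invrK.
have S0 := lt_le_trans ltr01 sum_carpet_ge1.
by rewrite -[RHS]ltr_ln ?posrE ?powR_gt0 ?ltr0n ?(ltnW m1) // ln_powR mulrC.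
Qed.

Lemma carpet_dim_ge0 : 0 <= carpet_dim R D.
Proof.
have [m1 _] := andP mn.
by rewrite mulr_ge0 ?invr_ge0 ?ln_ge0 ?sum_carpet_ge1 // ler1n ltnW.
Qed.

Variable K : set (R * R).
Hypothesis hK : is_carpet D sigma eta K.

Lemma carpet_stable : stable n m (enum D) col row fx fy K.
Proof.
case: hK => _ _ KE d; rewrite mem_enum => dD p Kp; rewrite -carpet_mapE // KE.
by exists d => //; exists p.
Qed.

Lemma carpet_decomposition (p : R * R) : K p -> exists d q, [/\ d \in enum D, K q &
  p = (flip_map n (fx d) (col d) q.1, flip_map m (fy d) (row d) q.2)].
Proof.
case: hK => _ _ {1}-> [d /= dD [q Kq <-]].
by exists d, q; rewrite mem_enum carpet_mapE.
Qed.

Lemma enum_carpet_gt0 : (0 < size (enum D))%N.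
Proof. by rewrite -cardE card_gt0; apply/eqP. Qed.

Lemma carpet_measure_gt_dim (s : R) : carpet_dim R D < s ->
  hausdorff_measure s K = 0%E.
Proof.
move=> dims; have s0 : 0 <= s by rewrite ltW // (le_lt_trans carpet_dim_ge0).
case: hK => _ cK _; have [B bndK] := compact_sup_bound cK.
apply: measure_eq0 => delta e delta0 e0.
have := dims; rewrite gtr_carpet_dim -sum_carpet => lt_s.
have [js [d [dd Ud cov sumd]]] :=
  carpet_cover_upper carpet_system mn carpet_stable carpet_decomposition bndK
    enum_carpet_gt0 s0 lt_s delta0 e0.
apply: (@le_trans _ _ (\sum_(i <- js) d i `^ s)%:E); last by rewrite lee_fin.
apply: content_le_sum cov => //.
by move=> i /dd/andP[].
Qed.

Lemma carpet_measure_lt_dim (s : R) : 0 <= s -> s < carpet_dim R D ->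
  hausdorff_measure s K <> 0%E.
Proof.
move=> s0 sdim null; case: hK => -[p0 Kp0] cK _.
have [B bndK] := compact_sup_bound cK.
pose s' := (s + carpet_dim R D) / 2.
have ss' : s < s' by rewrite /s'; lra.
have : s' < carpet_dim R D by rewrite /s'; lra.
rewrite ltr_carpet_dim -sum_carpet => lt_s'.
have [c c0 lower] := carpet_cover_lower carpet_system mn carpet_stable Kp0 bndK
  enum_carpet_gt0 (le_trans s0 (ltW ss')) lt_s'.
have sss' : 0 <= s < s' by rewrite s0.
have c4 : 0 < c / 4 by rewrite divr_gt0.
have [F [x [r [r0 cov sumr]]]] := ball_cover_of_null cK sss' null c4.
have := le_trans (lower F x r (fun k _ => r0 k) cov) sumr.
rewrite -mulr_natl; lra.
Qed.

Lemma carpet_hausdorff_dim : hausdorff_dim K = (carpet_dim R D)%:E.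
Proof.
apply/eqP; rewrite eq_le; apply/andP; split.
  apply/lee_addgt0Pr => e e0; apply: ereal_inf_lbound.
  exists (carpet_dim R D + e); last by rewrite EFinD.
  have dime : carpet_dim R D < carpet_dim R D + e by rewrite ltrDl.
  split; last exact: carpet_measure_gt_dim.
  by rewrite ltW // (le_lt_trans carpet_dim_ge0).
apply/ereal_infP => _ [s [s0 null] <-]; rewrite lee_fin leNgt.
by apply/negP => /(carpet_measure_lt_dim s0)/(_ null).
Qed.

End Carpet.

Theorem theorem1p1 (R : realType) (n m : nat) (hm : (2 <= m)%N)
    (hmn : (m < n)%N) (D : {set 'I_n * 'I_m}) (hD : D <> finset.set0)
    (sigma eta : 'I_n * 'I_m -> int)
    (hsigma : forall d, d \in D -> is_sign (sigma d))
    (heta : forall d, d \in D -> is_sign (eta d))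
    (K : set (R * R)) (hK : is_carpet D sigma eta K) :
  (row_constant D eta -> hausdorff_dim K = (carpet_dim R D)%:E) /\
  ((forall d, d \in D -> eta d = 1) ->
     hausdorff_dim K = (carpet_dim R D)%:E).
Proof.
have mn : (1 < m < n)%N by rewrite hm hmn.
split=> [rowc|eta1]; first exact: (carpet_hausdorff_dim mn hD hsigma heta rowc hK).
apply: (carpet_hausdorff_dim mn hD hsigma heta _ hK) => j _.
exists 1; split; first by left.
by move=> i; rewrite inE => /eta1.
Qed.
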